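(* Consider the infinite-horizon version of Problem P2. For every $\epsilon>0$ there exist globally $\epsilon$-optimal policies $G^1,G^2$ for observers O1 and O2 respectively (i.e. the expected cost of $(G^1,G^2)$ is at most $\epsilon$ more than the infimum of the expected cost over all pairs of policies), such that $G^1$ is characterized by 4 time-varying thresholds, that is, for each $t=1,2,\dots$ there are $0\le\alpha_t\le\beta_t\le\delta_t\le\theta_t\le1$ such that under $G^1$ $$Z^1_t=\begin{cases} b & \text{if } \pi^1_t<\alpha_t\\ 1 & \text{if } \alpha_t\le\pi^1_t\le\beta_t\\ b & \text{if } \beta_t<\pi^1_t<\delta_t\\ 0 & \text{if } \delta_t\le\pi^1_t\le\theta_t\\ b & \text{if } \pi^1_t>\theta_t.\end{cases}$$
   Context: **Model.** $H\in\{0,1\}$ is random with known prior $P(H=0)=p_0$, $P(H=1)=1-p_0$. There are two observers O1, O2. $Y^i_t\in\mathcal{Y}^i$ is the observation of O$i$ at time $t=1,2,\dots$; given $H$, it has either a discrete distribution $P^i_t(\cdot|H)$ or a density $f^i_t(\cdot|H)$. Given $H$, the observations of each observer at different times are independent, and the two observation sequences are independent. $X_{1:t}$ denotes $X_1,\dots,X_t$; $b$ is a blank message (no transmission). **O1.** As long as it has not sent a final message, at time $t$ O1 chooses $Z^1_t=\gamma^1_t(Y^1_{1:t})\in\{0,1,b\}$; $\tau^1=\min\{t: Z^1_t\in\{0,1\}\}$. It sends nothing afterwards and gets no feedback from O2. O1's belief is $\pi^1_t=P(H=0|Y^1_{1:t})$. **Infinite-horizon Problem P2.** O2 takes measurements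 from time $t=1$; at each time $t$, after O1's action at time $t$, O2 (if not stopped) chooses $U^2_t=\gamma^2_t(Y^2_{1:t},Z^1_{1:t})\in\{0,1,N\}$ ($N$ = continue), where for $t>\tau^1$ the sequence $Z^1_{1:t}$ means $Z^1_{1:\tau^1}$; $\tau^2=\min\{t:U^2_t\in\{0,1\}\}$. O2 may stop before O1 does. $\tau^1,\tau^2$ need not be bounded. The objective is to minimize $\mathbb{E}^{\Gamma^1,\Gamma^2}\{c^1\tau^1+c^2\tau^2+J(U^2_{\tau^2},H)\}$ over $\Gamma^1=(\gamma^1_1,\gamma^1_2,\dots)$, $\Gamma^2=(\gamma^2_1,\gamma^2_2,\dots)$, where $c^1,c^2$ are finite positive numbers and $0\le J\le L<\infty$, $J(0,1)>J(1,1)$, $J(1,0)>J(0,0)$. **Convention.** If a point belongs to two cases of the threshold rule (possible only at $\pi^1_t=\beta_t=\delta_t$), the first listed applicable case is used. *)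

(* Defs.v *)
From HB Require Import structures.
From mathcomp Require Import all_boot all_order all_algebra.
From mathcomp Require Import all_classical all_reals all_analysis.

Set Implicit Arguments.
Unset Strict Implicit.
Unset Printing Implicit Defensive.

Import Order.TTheory GRing.Theory Num.Theory.

Local Open Scope classical_set_scope.
Local Open Scope ring_scope.

(* Time is 0-based: the index t : nat stands for time t + 1, so that Y t is
   the observation usually written Y_{t+1}.
   H : Omega -> bool, with false for H = 0 and true for H = 1.
   Messages of O1 and actions of O2 have type option bool: Some false is 0,
   Some true is 1, and None is b (blank) for O1 and N (continue) for O2. *)

Section Model.
Context {d : measure_display} {Omega : measurableType d} {R : realType}.
Variables (P : probability Omega R) (H : Omega -> bool).

(* P(E | H = h); meaningful only when P(H = h) > 0, which every use assumes. *)
Definition condP (h : bool) (E : set Omega) : R :=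
  fine (P (E `&` [set w | H w = h])) / fine (P [set w | H w = h]).

Definition mutually_independent (Q : set Omega -> R) {d'} {T : measurableType d'}
    (Y : nat -> Omega -> T) : Prop :=
  forall (s : seq nat) (B : nat -> set T), uniq s ->
    (forall t, measurable (B t)) ->
    Q (\bigcap_(t in [set` s]) (Y t @^-1` B t)) =
    \prod_(t <- s) Q (Y t @^-1` B t).

(* The sigma-algebra on Omega generated by the whole sequence Y. *)
Definition sigma_seq {d'} {T : measurableType d'} (Y : nat -> Omega -> T) :
    set_system Omega :=
  <<s [set E | exists t (B : set T), measurable B /\ E = Y t @^-1` B] >>.

Definition independent_seqs (Q : set Omega -> R) {d1 d2}
    {T1 : measurableType d1} {T2 : measurableType d2}
    (Y1 : nat -> Omega -> T1) (Y2 : nat -> Omega -> T2) : Prop :=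
  forall E1 E2, sigma_seq Y1 E1 -> sigma_seq Y2 E2 ->
    Q (E1 `&` E2) = Q E1 * Q E2.

Definition discrete_law {d'} {T : measurableType d'} (mu : set T -> R) : Prop :=
  exists p : T -> R, (forall y, 0 <= p y) /\
    (forall A, measurable A -> ((mu A)%:E = \esum_(y in A) (p y)%:E)%E).

(* Densities are taken with respect to a reference measure nu on the
   observation space (e.g. Lebesgue measure). *)
Definition density_law {d'} {T : measurableType d'}
    (nu : {sigma_finite_measure set T -> \bar R}) (mu : set T -> R) : Prop :=
  exists f : T -> R, [/\ measurable_fun setT f, (forall y, 0 <= f y) &
    (forall A, measurable A -> ((mu A)%:E = \int[nu]_(y in A) (f y)%:E)%E)].

Definition observation_model {d1 d2}
    {T1 : measurableType d1} {T2 : measurableType d2}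
    (nu1 : {sigma_finite_measure set T1 -> \bar R})
    (nu2 : {sigma_finite_measure set T2 -> \bar R})
    (Y1 : nat -> Omega -> T1) (Y2 : nat -> Omega -> T2) : Prop :=
  forall h : bool, (0 < P [set w | H w = h])%E ->
    [/\ (forall t, let mu A := condP h (Y1 t @^-1` A) in
           discrete_law mu \/ density_law nu1 mu),
        (forall t, let mu A := condP h (Y2 t @^-1` A) in
           discrete_law mu \/ density_law nu2 mu),
        mutually_independent (condP h) Y1,
        mutually_independent (condP h) Y2 &
        independent_seqs (condP h) Y1 Y2].

Definition history {T : Type} (Y : nat -> Omega -> T) (t : nat) (w : Omega) :
    t.+1.-tuple T :=
  [tuple Y i w | i < t.+1].

(* pi t is a version of the conditional probability P(H = 0 | Y_{1:t+1}),
   written as a function of the observed history. *)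
Definition is_belief {d1} {T : measurableType d1} (Y : nat -> Omega -> T)
    (pi : forall t, t.+1.-tuple T -> R) : Prop :=
  forall t, [/\ measurable_fun setT (pi t),
    P.-integrable setT (fun w => (pi t (history Y t w))%:E) &
    forall A : set (t.+1.-tuple T), measurable A ->
      (\int[P]_(w in history Y t @^-1` A) (pi t (history Y t w))%:E =
       P (history Y t @^-1` A `&` [set w | H w = false]))%E].

End Model.

Definition policy1 (T : Type) := forall t : nat, t.+1.-tuple T -> option bool.

(* The second argument is the list of O1's messages so far, cut off at O1's final message. *)
Definition policy2 (T : Type) :=
  forall t : nat, t.+1.-tuple T -> seq (option bool) -> option bool.

Definition admissible1 {d1} {T : measurableType d1} (g1 : policy1 T) : Prop :=
  forall t z, measurable [set y | g1 t y = z].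

Definition admissible2 {d2} {T : measurableType d2} (g2 : policy2 T) : Prop :=
  forall t zs u, measurable [set y | g2 t y zs = u].

(* min {t | s t is a final (non-None) action}; None when there is none. *)
Definition stop_index (s : nat -> option bool) : option nat :=
  match pselect (exists t, isSome (s t)) with
  | left ex => Some (ex_minn ex)
  | right _ => None
  end.

Definition stop_time {R : realType} (s : nat -> option bool) : \bar R :=
  if stop_index s is Some t then (t.+1%:R)%:E else +oo%E.

Section Cost.
Context {d : measure_display} {Omega : measurableType d} {R : realType}.
Variables (P : probability Omega R) (H : Omega -> bool).
Context {T1 T2 : Type}.
Variables (Y1 : nat -> Omega -> T1) (Y2 : nat -> Omega -> T2).
Variables (c1 c2 : R) (J : bool -> bool -> R).
Variables (g1 : policy1 T1) (g2 : policy2 T2).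

(* Values after the first final message are never sent: they influence neither
   stop_time (Z1 w) nor sent1, which is Z^1_{1:t} stopped at tau^1. *)
Definition Z1 (w : Omega) (t : nat) : option bool := g1 (history Y1 t w).

Definition sent1 (w : Omega) (t : nat) : seq (option bool) :=
  let zs := [seq Z1 w k | k <- iota 0 t.+1] in take (find isSome zs).+1 zs.

Definition U2 (w : Omega) (t : nat) : option bool :=
  g2 (history Y2 t w) (sent1 w t).

(* J(U^2_{tau^2}, H); the value 0 on tau^2 = oo is immaterial, since the cost
   is infinite there. *)
Definition terminal_cost (w : Omega) : R :=
  if stop_index (U2 w) is Some t then
    if U2 w t is Some u then J u (H w) else 0
  else 0.

Definition expected_cost : \bar R :=
  (\int[P]_w (c1%:E * stop_time (Z1 w) + c2%:E * stop_time (U2 w)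
              + (terminal_cost w)%:E))%E.

End Cost.

Definition optimal_cost {d} {Omega : measurableType d} {R : realType}
    (P : probability Omega R) (H : Omega -> bool)
    {d1 d2} {T1 : measurableType d1} {T2 : measurableType d2}
    (Y1 : nat -> Omega -> T1) (Y2 : nat -> Omega -> T2)
    (c1 c2 : R) (J : bool -> bool -> R) : \bar R :=
  ereal_inf [set x | exists (g1 : policy1 T1) (g2 : policy2 T2),
    [/\ admissible1 g1, admissible2 g2 &
        x = expected_cost P H Y1 Y2 c1 c2 J g1 g2]].

Definition threshold_rule {R : realType} (alpha beta delta theta p : R) :
    option bool :=
  if p < alpha then None
  else if alpha <= p <= beta then Some true
  else if beta < p < delta then None
  else if delta <= p <= theta then Some false
  else None.

(* Main.v *)
Require Import Defs.
From HB Require Import structures.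
From mathcomp Require Import all_boot all_order all_algebra.
From mathcomp Require Import all_classical all_reals all_analysis.
From mathcomp Require Import measurable_realfun lra.

(** Why the theorem holds.  Start from a pair of policies whose expected cost is
    finite and close to the infimum.  Each step of O2 costs [c2 > 0], so by
    Markov's inequality O2 is still running at a late time [N] only with small
    probability; halting both observers at [N] then adds at most [L] times that
    probability ([truncation]).

    Now keep the policy of O2.  Once O1 has first stopped at time [t] with
    message [z], O2 only sees its own observations, and given [H] these are
    independent of those of O1.  Hence, given [H = h], the whole cost has a mean
    [signal_cost h t z] that depends on [(h, t, z)] alone, and O1 faces an
    ordinary optimal stopping problem ([expected_cost_average]).

    In that problem the decisions are put into threshold form one time after
    the other ([improve_at], iterated in [threshold_policy]).  Given [H] the
    past of O1 is independent of its future ([freeze_past]), so going on after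
    the past [x] has a mean cost [restart_cost h x] given [H = h], and the
    average cost is the expectation of
    [pi * restart_cost 0 X + (1 - pi) * restart_cost 1 X] where [pi] is the
    belief given the past [X] ([average_cost_restart]).  So every option
    available at time [t] -- send 0, send 1, or go on as if the past had been
    some fixed [x] -- has a cost which is affine in the belief.  The pairs of
    costs of going on are bounded, hence up to an arbitrarily small error
    finitely many pasts [x] represent all of them ([continuation_net]), and
    replacing the decision at time [t] by the cheapest of these finitely many
    options hardly raises the cost.

    The beliefs at which a given message is the cheapest option are cut out of
    [0, 1] by finitely many affine inequalities, so they form an interval, and
    the intervals of the two messages overlap in at most an end point unless
    both messages cost the same ([choice_threshold]).  This is the rule with
    four thresholds, up to exchanging the two messages.  The exchange is free: O2
    can undo it ([pair_cost_relabel]).  A rule with thresholds always sends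
    something at the belief [alpha]; when no message is ever the cheapest
    option, all four thresholds are put on one value that the belief takes with
    probability zero ([belief_non_atom]). *)

Set Implicit Arguments.
Unset Strict Implicit.
Unset Printing Implicit Defensive.

Import Order.TTheory GRing.Theory Num.Theory.
Import numFieldNormedType.Exports.

Local Open Scope classical_set_scope.
Local Open Scope ring_scope.

(** * Maps into countable types with measurable fibres *)

Section DiscreteMaps.
Context {d : measure_display} {X : measurableType d}.

(** Messages, decisions and stopping times range over countable types without a
    fixed sigma-algebra; for maps into them, measurable fibres are enough. *)
Definition measurable_fibres {C : Type} (f : X -> C) :=
  forall c, measurable [set x | f x = c].

Lemma fibres_preimage {C : countType} (f : X -> C) (B : set C) :
  measurable_fibres f -> measurable [set x | B (f x)].
Proof.
move=> mf; rewrite (_ : mkset _ = \bigcup_(c in [set: C]) [set x | B c /\ f x = c]).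
  apply: countable_bigcupT_measurable => [|c]; first exact: countableP.
  have [Bc|nBc] := pselect (B c).
    by rewrite (_ : mkset _ = [set x | f x = c])//; apply/seteqP; split=> x //= [].
  by rewrite (_ : mkset _ = set0)//; apply/seteqP; split=> x //= [].
by apply/seteqP; split=> [x Bx|x /= [c _ [Bc ->]]//]; exists (f x).
Qed.

Lemma fibres_comp {C : countType} {D : Type} (F : C -> D) (f : X -> C) :
  measurable_fibres f -> measurable_fibres (fun x => F (f x)).
Proof. by move=> mf c; exact: (fibres_preimage [set e | F e = c] mf). Qed.

(** The argument selected by [k] takes countably many values, so a fibre is a
    countable union.  Used for a policy applied to a random list of messages,
    and for reading a sequence at a random index. *)
Lemma fibres_switch {C : countType} {D : Type} (k : X -> C) (f : C -> X -> D) :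
  measurable_fibres k -> (forall c, measurable_fibres (f c)) ->
  measurable_fibres (fun x => f (k x) x).
Proof.
move=> mk mf v.
rewrite (_ : mkset _ = \bigcup_(c in [set: C])
  ([set x | k x = c] `&` [set x | f c x = v])).
  apply: countable_bigcupT_measurable => [|c]; first exact: countableP.
  by apply: measurableI; [exact: mk|exact: mf].
by apply/seteqP; split=> [x fx|x [c _ [/= <-]]//]; exists (k x).
Qed.

Lemma fibres_cst {C : Type} (c : C) : measurable_fibres (fun _ : X => c).
Proof.
move=> v; have [->|cv] := pselect (c = v).
  by rewrite (_ : mkset _ = setT)//; apply/seteqP; split.
by rewrite (_ : mkset _ = set0)//; apply/seteqP; split.
Qed.

Lemma fibres_pair {C D : countType} (f : X -> C) (g : X -> D) :
  measurable_fibres f -> measurable_fibres g ->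
  measurable_fibres (fun x => (f x, g x)).
Proof.
move=> mf mg; apply: (fibres_switch (f := fun c x => (c, g x))) => // c.
exact: fibres_comp.
Qed.

Lemma fibres_map {D : countType} (f : nat -> X -> D) (s : seq nat) :
  (forall k, measurable_fibres (f k)) ->
  measurable_fibres (fun x => [seq f k x | k <- s]).
Proof.
move=> mf; elim: s => [|k s IH] /=; first exact: fibres_cst.
exact: (fibres_comp (fun p => p.1 :: p.2) (fibres_pair (mf k) IH)).
Qed.

Lemma fibres_ffun {I : finType} {D : countType} (f : I -> X -> D) :
  (forall i, measurable_fibres (f i)) ->
  measurable_fibres (fun x => [ffun i => f i x]).
Proof.
move=> mf c; rewrite (_ : mkset _ = \bigcap_(i in [set: I]) [set x | f i x = c i]).
  by apply: fin_bigcap_measurable => [|i _]; [exact: finite_finset|exact: mf].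
apply/seteqP; split=> [x /= <- i _ /=|x h]; first by rewrite ffunE.
by apply/ffunP => i; rewrite ffunE; exact: h.
Qed.

Lemma fibres_le {R : realType} (f g : X -> R) :
  measurable_fun setT f -> measurable_fun setT g ->
  measurable_fibres (fun x => f x <= g x).
Proof.
move=> mf mg; have m := measurable_fun_le measurableT mf mg.
rewrite setTI in m; case.
  by rewrite (_ : mkset _ = [set x | f x <= g x]).
rewrite (_ : mkset _ = ~` [set x | f x <= g x]); first exact: measurableC.
by apply/seteqP; split=> x /= => [->//|/negP/negbTE].
Qed.

Lemma fibres_measurable_fun {d'} {Y : measurableType d'} {C : countType}
    (F : C -> Y) (f : X -> C) :
  measurable_fibres f -> measurable_fun setT (fun x => F (f x)).
Proof.
by move=> mf _ B _; rewrite setTI; exact: (fibres_preimage (F @^-1` B) mf).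
Qed.

End DiscreteMaps.

Lemma fibres_precomp {d d'} {X : measurableType d} {Y : measurableType d'}
    {C : Type} (f : Y -> C) (phi : X -> Y) :
  measurable_fun setT phi -> measurable_fibres f ->
  measurable_fibres (fun x => f (phi x)).
Proof.
by move=> mphi mf c; rewrite -[mkset _]setTI; exact: (mphi measurableT _ (mf c)).
Qed.

(** * First final actions *)

Definition first_stop (s : nat -> option bool) (t : nat) (z : bool) : Prop :=
  s t = Some z /\ forall k, (k < t)%N -> s k = None.

Lemma first_stop_index s t z :
  first_stop s t z <-> stop_index s = Some t /\ s t = Some z.
Proof.
rewrite /first_stop /stop_index; case: pselect => [ex|nex]; last first.
  by split=> [[st _]|[]//]; case: nex; exists t; rewrite st.
case: ex_minnP => m sm mmin; split=> [[st lt]|[[<-] st]].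
  have /mmin mt : isSome (s t) by rewrite st.
  split=> //; congr Some; apply/eqP; rewrite eqn_leq mt leqNgt.
  by apply/negP => /lt sm0; rewrite sm0 in sm.
split=> // k km; case E : (s k) => [u|//].
have /mmin : isSome (s k) by rewrite E.
by rewrite leqNgt km.
Qed.

Lemma first_stop_uniq s t z t' z' :
  first_stop s t z -> first_stop s t' z' -> t = t' /\ z = z'.
Proof.
move=> /first_stop_index[e sz] /first_stop_index[e' sz'].
by move: e'; rewrite e => -[tt']; move: sz'; rewrite -tt' sz => -[].
Qed.

Lemma first_stop_ex s N : s N <> None ->
  exists t z, (t <= N)%N /\ first_stop s t z.
Proof.
move=> sN; have ex : exists t, isSome (s t) by exists N; case: (s N) sN.
case: (ex_minnP ex) => t st tmin; case E : (s t) st => [z|//] _.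
exists t, z; split; first by apply: tmin; case: (s N) sN.
split=> // k kt; case E' : (s k) => [u|//].
by have := tmin k; rewrite E' leqNgt kt => /(_ isT).
Qed.

Lemma first_stop_eq s s' t z : (forall k, (k <= t)%N -> s k = s' k) ->
  first_stop s t z <-> first_stop s' t z.
Proof.
move=> e; rewrite /first_stop e//; split=> -[-> h]; split=> // k kt.
  by rewrite -e 1?ltnW// h.
by rewrite e 1?ltnW// h.
Qed.

Section StopIndexMeasurable.
Context {d : measure_display} {X : measurableType d}.

Lemma fibres_first_stop (s : X -> nat -> option bool) t z :
  (forall k, measurable_fibres (fun x => s x k)) ->
  measurable [set x | first_stop (s x) t z].
Proof.
move=> ms; rewrite (_ : mkset _ = [set x | s x t = Some z] `&`
    \bigcap_(k in `I_t) [set x | s x k = None]).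
  apply: measurableI; first exact: ms.
  by apply: fin_bigcap_measurable => // k _; exact: ms.
by apply/seteqP; split.
Qed.

Lemma fibres_stop_index (s : X -> nat -> option bool) :
  (forall k, measurable_fibres (fun x => s x k)) ->
  measurable_fibres (fun x => stop_index (s x)).
Proof.
move=> ms.
have mS t : measurable [set x | stop_index (s x) = Some t].
  rewrite (_ : mkset _ = [set x | first_stop (s x) t true] `|`
      [set x | first_stop (s x) t false]).
    by apply: measurableU; exact: fibres_first_stop.
  apply/seteqP; split=> [x /= e|x /= [] /first_stop_index[]//].
  have : s x t <> None.
    move: e; rewrite /stop_index; case: pselect => // ex [] <-.
    by case: ex_minnP => m; case: (s x m).
  by case E : (s x t) => [[]|]// _; [left|right]; apply/first_stop_index.
case=> [t|]; first exact: mS.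
rewrite (_ : mkset _ = ~` \bigcup_t [set x | stop_index (s x) = Some t]).
  by apply: measurableC; exact: bigcup_measurable.
apply/seteqP; split=> [x /= e [t _ /=]|x /= h]; first by rewrite e.
by case E : (stop_index _) => [t|//]; case: h; exists t.
Qed.

End StopIndexMeasurable.

(** * Histories as prefixes of paths *)

Section Paths.
Context {d : measure_display} {T : measurableType d}.
Implicit Types (y : nat -> T) (g : policy1 T).

Definition hist y t : t.+1.-tuple T := [tuple y i | i < t.+1].

Definition path_of {t} (x : t.+1.-tuple T) : nat -> T := nth point x.

(** The past of [y] up to [t] is replaced by [x], its future is kept. *)
Definition splice {t} (x : t.+1.-tuple T) y : nat -> T :=
  fun i => if (i <= t)%N then nth point x i else y i.

Definition actions g y : nat -> option bool := fun t => g t (hist y t).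

Lemma eq_hist y y' t : (forall i, (i <= t)%N -> y i = y' i) ->
  hist y t = hist y' t.
Proof. by move=> e; apply: eq_mktuple => i; apply: e; rewrite -ltnS. Qed.

Lemma nth_hist y t i : (i <= t)%N -> nth point (hist y t) i = y i.
Proof.
by move=> it; rewrite (nth_map ord0) ?size_enum_ord// nth_enum_ord.
Qed.

Lemma hist_path_of t (x : t.+1.-tuple T) : hist (path_of x) t = x.
Proof.
by apply: eq_from_tnth => i; rewrite tnth_mktuple /path_of (tnth_nth point).
Qed.

Lemma hist_splice_le t s (x : t.+1.-tuple T) y : (s <= t)%N ->
  hist (splice x y) s = hist (path_of x) s.
Proof.
move=> st; apply: eq_hist => i it.
by rewrite /splice (leq_trans it st).
Qed.

(** Splicing commutes with forgetting the entries after [s], so that a policy may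
    splice a foreign past into the history that it sees. *)
Lemma splice_path_of_hist t s (x : t.+1.-tuple T) y :
  hist (splice x (path_of (hist y s))) s = hist (splice x y) s.
Proof.
apply: eq_hist => i it; rewrite /splice; case: ifP => // _.
by rewrite /path_of nth_hist.
Qed.

Lemma actions_path_of_hist g y s k : (k <= s)%N ->
  actions g (path_of (hist y s)) k = actions g y k.
Proof.
move=> ks; rewrite /actions; congr (g k _); apply: eq_hist => i ik.
by rewrite /path_of nth_hist// (leq_trans ik).
Qed.

(** [first_stop] only reads the actions up to [t], so it is an event on histories
    of length [t + 1]. *)
Definition stop_set g t z : set (t.+1.-tuple T) :=
  [set x | first_stop (actions g (path_of x)) t z].

Lemma stop_set_hist g t z y :
  stop_set g z (hist y t) = first_stop (actions g y) t z.
Proof. by apply/propext; apply: first_stop_eq => k kt; exact: actions_path_of_hist. Qed.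

Lemma measurable_hist {d'} {X : measurableType d'} (f : X -> nat -> T) t :
  (forall i, measurable_fun setT (fun x => f x i)) ->
  measurable_fun setT (fun x => hist (f x) t).
Proof.
move=> mf; apply/measurable_fun_tnthP => i /=.
rewrite (_ : _ \o _ = fun x => f x i); first exact: mf.
by apply/funext => x /=; rewrite tnth_mktuple.
Qed.

Lemma measurable_nth t i :
  measurable_fun setT (fun x : t.+1.-tuple T => nth point x i).
Proof.
have [it|it] := ltnP i t.+1.
  rewrite (_ : (fun x => _) = fun x : t.+1.-tuple T => tnth x (Ordinal it)).
    exact: measurable_tnth.
  by apply/funext => x; rewrite (tnth_nth point).
rewrite (_ : (fun x => _) = fun=> point) //.
by apply/funext => x; rewrite nth_default// size_tuple.
Qed.

Lemma fibres_actions {d'} {X : measurableType d'} (f : X -> nat -> T) g t :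
  admissible1 g -> (forall i, measurable_fun setT (fun x => f x i)) ->
  measurable_fibres (fun x => actions g (f x) t).
Proof.
move=> mg mf; apply: (@fibres_precomp _ _ _ _ _ (g t)); last exact: mg.
exact: measurable_hist.
Qed.

Lemma measurable_stop_set g t z : admissible1 g -> measurable (stop_set g (t := t) z).
Proof.
move=> mg; apply: fibres_first_stop => k; apply: fibres_actions => // i.
exact: measurable_nth.
Qed.

Lemma measurable_splice {d'} {X : measurableType d'} t
    (x : X -> t.+1.-tuple T) (f : X -> nat -> T) i :
  measurable_fun setT x -> (forall i, measurable_fun setT (fun w => f w i)) ->
  measurable_fun setT (fun w => splice (x w) (f w) i).
Proof.
move=> mx mf; rewrite /splice; case: (leqP i t) => // _.
exact: (measurableT_comp (@measurable_nth t i) mx).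
Qed.

(** The rectangles form a pi-system, unlike the cylinders on one coordinate by
    which the sigma-algebra on tuples is defined; this is what uniqueness of
    measures requires. *)
Lemma measurable_tuple_rectangles n : (@measurable _ (n.+1.-tuple T)) =
  <<s [set F | exists B : nat -> set T, (forall i, measurable (B i)) /\
        F = [set x : n.+1.-tuple T | forall i, (i <= n)%N -> B i (nth point x i)]] >>.
Proof.
apply/seteqP; split.
  apply: smallest_sub; first exact: smallest_sigma_algebra.
  rewrite -bigcup_mkord_ord => A [i /= ilt [B mB <-]].
  apply: sub_sigma_algebra.
  exists (fun j => if j == i then B else setT); split=> [j|].
    by case: ifP => // _; exact: measurableT.
  apply/seteqP; split=> [x /= [_ Bx] j jn|x /= h].
    case: eqP => // ->; move: Bx; rewrite (tnth_nth point)/= inordK//.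
  split => //; have := h i ilt; rewrite eqxx (tnth_nth point)/= inordK//.
apply: smallest_sub; first exact: sigma_algebra_measurable.
move=> _ [B [mB ->]].
rewrite (_ : mkset _ = \bigcap_(i in `I_n.+1) [set x : n.+1.-tuple T | B i (nth point x i)]).
  apply: fin_bigcap_measurable => // i _.
  by rewrite -[X in measurable X]setTI; apply: measurable_nth => //; exact: mB.
by apply/seteqP; split.
Qed.

End Paths.

(** * Freezing the past, and densities *)

Section Freeze.
Context {d : measure_display} {Omega : measurableType d} {R : realType}.
Context {d' : measure_display} {T : measurableType d'}.
Variables (Q : probability Omega R) (Y : nat -> Omega -> T).
Hypothesis mY : forall i, measurable_fun setT (Y i).
Let path w i := Y i w.

Let mpath_hist n : measurable_fun setT (fun w => hist (path w) n).
Proof. by apply: measurable_hist => i; exact: mY. Qed.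

Let mixed t s (p : t.+1.-tuple T * Omega) := hist (splice p.1 (path p.2)) s.

Let mmixed t s : measurable_fun setT (@mixed t s).
Proof.
apply: measurable_hist => i; apply: measurable_splice => // j.
by apply: (measurableT_comp (mY j)).
Qed.

Let xsection_mixed t s (F : set (s.+1.-tuple T)) x :
  xsection (@mixed t s @^-1` F) x = [set w | F (hist (splice x (path w)) s)].
Proof. by rewrite xsectionE. Qed.

Lemma measurable_splice_probability t s (F : set (s.+1.-tuple T)) : measurable F ->
  measurable_fun setT (fun x : t.+1.-tuple T => Q [set w | F (hist (splice x (path w)) s)]).
Proof.
move=> mF; have mMF : measurable (@mixed t s @^-1` F).
  by rewrite -[_ @^-1` _]setTI; exact: mmixed.
have := measurable_fun_xsection Q mMF.
by apply: eq_measurable_fun => x _ /=; rewrite xsection_mixed.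
Qed.

Hypothesis indY : forall (s : seq nat) (B : nat -> set T), uniq s ->
  (forall i, measurable (B i)) ->
  Q (\bigcap_(i in [set` s]) (Y i @^-1` B i)) = (\prod_(i <- s) Q (Y i @^-1` B i))%E.

(** By independence, an independent copy of the past followed by the actual
    future has the law of the whole history: both laws agree on rectangles, where
    each is the same product of probabilities. *)
Lemma freeze_past t s (F : set (s.+1.-tuple T)) : measurable F ->
  Q [set w | F (hist (path w) s)] =
  (\int[Q]_w' Q [set w | F (hist (splice (hist (path w') t) (path w)) s)])%E.
Proof.
move=> mF.
pose X : {mfun Omega >-> t.+1.-tuple T} := HB.pack (fun w => hist (path w) t)
  (isMeasurableFun.Build _ _ _ _ _ (@mpath_hist t)).
pose V : {mfun Omega >-> s.+1.-tuple T} := HB.pack (fun w => hist (path w) s)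
  (isMeasurableFun.Build _ _ _ _ _ (@mpath_hist s)).
pose M : {mfun (t.+1.-tuple T * Omega)%type >-> s.+1.-tuple T} := HB.pack (@mixed t s)
  (isMeasurableFun.Build _ _ _ _ _ (@mmixed t s)).
pose mu : probability _ _ := distribution Q X.
transitivity (pushforward Q V F); first by [].
transitivity (pushforward (mu \x Q)%E M F); last first.
  rewrite /pushforward/= /product_measure1/=.
  rewrite (eq_integral (fun x => Q [set w | F (hist (splice x (path w)) s)])); last first.
    by move=> x _; rewrite /= xsection_mixed.
  by rewrite ge0_integral_pushforward//; exact: measurable_splice_probability.
apply: (measure_unique _ (fun=> setT) (@measurable_tuple_rectangles _ T s)) => //.
- move=> _ _ [B [mB ->]] [C [mC ->]]; exists (fun i => B i `&` C i); split.
    by move=> i; exact: measurableI.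
  by apply/seteqP; split=> [x [/= b c] i it|x /= bc]; [split; auto|split=> i it; apply bc].
- by move=> _; exists (fun=> setT); split=> //; apply/seteqP; split.
- by rewrite bigcup_const.
- move=> _ [B [mB ->]].
  have seqE (p : pred nat) : [set w | forall i, (i <= s)%N -> p i -> B i (Y i w)] =
      \bigcap_(i in [set` [seq i <- iota 0 s.+1 | p i]]) (Y i @^-1` B i).
    have memE i : (i \in [seq i <- iota 0 s.+1 | p i]) = p i && (i <= s)%N.
      by rewrite mem_filter mem_iota.
    apply/seteqP; split=> [w h i si|w h i it pit].
      by have := memE i; rewrite [_ \in _]si => /esym/andP[pit it]; exact: h.
    by apply: h; rewrite /mkset memE pit.
  have QE (p : pred nat) : Q [set w | forall i, (i <= s)%N -> p i -> B i (Y i w)] =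
      (\prod_(i <- iota 0 s.+1 | p i) Q (Y i @^-1` B i))%E.
    by rewrite seqE indY ?filter_uniq ?iota_uniq// big_filter.
  transitivity (Q [set w | forall i, (i <= s)%N -> xpredT i -> B i (Y i w)]).
    rewrite /pushforward/=; congr (Q _); apply/seteqP; split=> w /= h i it.
      by move=> _; have := h i it; rewrite nth_hist.
    by rewrite nth_hist//; exact: h.
  rewrite QE (bigID (fun i => (i <= t)%N))/= -!QE.
  have -> : pushforward (mu \x Q)%E M
      [set x : s.+1.-tuple T | forall i, (i <= s)%N -> B i (nth point x i)] =
      ((mu \x Q) ([set x : t.+1.-tuple T |
        forall i, (i <= s)%N -> (i <= t)%N -> B i (nth point x i)]
      `*` [set w | forall i, (i <= s)%N -> ~~ (i <= t)%N -> B i (Y i w)]))%E.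
    rewrite /pushforward; congr ((_ \x _)%E _).
    apply/seteqP; split=> [[x w] /= h|[x w] [/= h1 h2] i it].
      split=> /= i it; have := h i it; rewrite nth_hist// /splice.
        by move=> + it'; rewrite it'.
      by case: ifP.
    rewrite nth_hist// /splice; case: ifPn => it'; first exact: h1.
    exact: h2.
  rewrite product_measure1E.
  + congr (_ * _)%E; rewrite /mu/= /distribution /pushforward/=; congr (Q _).
    apply/seteqP; split=> w /= h i it it'.
      by rewrite nth_hist//; exact: h.
    by have := h i it it'; rewrite nth_hist.
  + rewrite (_ : mkset _ = \bigcap_(i in [set i | (i <= s)%N /\ (i <= t)%N])
        [set x : t.+1.-tuple T | B i (nth point x i)]).
      apply: fin_bigcap_measurable => [|i _].
        by apply: (sub_finite_set _ (finite_II s.+1)) => i /= [].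
      by rewrite -[X in measurable X]setTI; apply: measurable_nth => //; exact: mB.
    by apply/seteqP; split=> [x h i /= []|x h i it it']; [exact: h|exact: h].
  + rewrite seqE; apply: fin_bigcap_measurable => // i _.
    by rewrite -[X in measurable X]setTI; exact: mY.
- by move=> _; rewrite (le_lt_trans (probability_le1 _ _)) ?ltry//=; exact: measurableT.
Qed.

End Freeze.

Section Density.
Local Open Scope ereal_scope.
Context {d : measure_display} {Omega : measurableType d} {R : realType}.
Context {d' : measure_display} {T : measurableType d'}.
Variables (P Q : {measure set Omega -> \bar R}) (X : Omega -> T) (p : R) (rho : Omega -> R).
Hypotheses (mX : measurable_fun setT X) (mrho : measurable_fun setT rho).
Hypothesis rho0 : forall w, (0 <= rho w)%R.
Hypothesis rhoE : forall A, measurable A ->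
  p%:E * Q (X @^-1` A) = \int[P]_(w in X @^-1` A) (rho w)%:E.

Import HBNNSimple.

(** The change of density on the sigma-algebra of [X], from sets to nonnegative
    functions by simple approximation.  The density [rho] is a function on
    [Omega], which need not be generated by [X]; [p] is a prior probability and
    may vanish. *)
Lemma integral_density (f : T -> \bar R) : measurable_fun setT f ->
  (forall x, 0 <= f x) ->
  p%:E * \int[Q]_w f (X w) = \int[P]_w (f (X w) * (rho w)%:E).
Proof.
move=> mf f0; pose h := nnsfun_approx measurableT mf.
have mh n : measurable_fun setT (fun w => h n (X w)) by exact: measurableT_comp.
have hE x : f x = lim ((h n x)%:E @[n --> \oo]).
  by apply/esym/cvg_lim => //; exact: cvg_nnsfun_approx.
have mhE n : measurable_fun setT (fun w => (h n (X w))%:E) by exact/measurable_EFinP.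
have mrhoE : measurable_fun setT (fun w => (rho w)%:E) by exact/measurable_EFinP.
have -> : \int[Q]_w f (X w) = lim (\int[Q]_w (h n (X w))%:E @[n --> \oo]).
  under eq_integral => w _ do rewrite hE.
  apply: monotone_convergence => //.
  - by move=> n w _; rewrite lee_fin.
  - by move=> w _ a b ab; rewrite lee_fin; exact/lefP/nd_nnsfun_approx.
have -> : \int[P]_w (f (X w) * (rho w)%:E) =
    lim (\int[P]_w ((h n (X w))%:E * (rho w)%:E) @[n --> \oo]).
  have fg w : f (X w) * (rho w)%:E = lim ((h n (X w))%:E * (rho w)%:E @[n --> \oo]).
    apply/esym/cvg_lim => //; apply: cvgeZr; first by [].
    exact: cvg_nnsfun_approx.
  under eq_integral => w _ do rewrite fg.
  apply: monotone_convergence => //.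
  - by move=> n; exact: emeasurable_funM.
  - by move=> n w _; rewrite mule_ge0 ?lee_fin.
  - by move=> w _ a b ab; rewrite lee_wpmul2r ?lee_fin//; exact/lefP/nd_nnsfun_approx.
rewrite -limeMl//; last first.
  apply: ereal_nondecreasing_is_cvgn => a b ab; apply: ge0_le_integral => //.
  - by move=> w _; rewrite lee_fin.
  - by move=> w _; rewrite lee_fin; exact/lefP/nd_nnsfun_approx.
apply: congr_lim; apply/funext => n.
pose A r := h n @^-1` [set r].
have mA r : measurable (A r) by rewrite /A.
have A0 r : (r < 0)%R -> A r = set0 by move=> r0; exact: preimage_nnfun0.
have mXA r : measurable (X @^-1` A r).
  by rewrite -[_ @^-1` _]setTI; exact: mX.
have mindX r : measurable_fun setT (fun w => \1_(A r) (X w) : R).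
  by apply: (measurableT_comp _ mX); exact: measurable_indic.
have mind r : measurable_fun setT (fun w => (r * \1_(A r) (X w))%:E).
  apply/measurable_EFinP; exact: measurable_funM.
have hnE w : (h n (X w))%:E = \sum_(r \in range (h n)) (r * \1_(A r) (X w))%:E.
  by rewrite fimfunE -fsumEFin.
have ind0 r w : 0 <= (r * \1_(A r) (X w))%:E by exact: nnfun_muleindic_ge0.
have iind r : 0 <= r%:E * Q (X @^-1` A r).
  have [r0|r0] := leP 0%R r; first by rewrite mule_ge0.
  by rewrite A0// preimage_set0 measure0 mule0.
transitivity (\sum_(r \in range (h n)) p%:E * (r%:E * Q (X @^-1` A r))).
  rewrite -ge0_mule_fsumr//; congr (_ * _).
  rewrite (eq_integral _ _ (fun w _ => hnE w)) ge0_integral_fsum//.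
  apply: eq_fsbigr => r _.
  under eq_integral do rewrite EFinM.
  have [r0|r0] := leP 0%R r.
    rewrite ge0_integralZl//; last exact/measurable_EFinP.
    by rewrite -[in RHS](setIT (X @^-1` A r)) -integral_indic.
  rewrite A0// preimage_set0 measure0 mule0 integral0_eq// => w _.
  by rewrite indic0 mule0.
transitivity (\int[P]_w (\sum_(r \in range (h n)) (r * \1_(A r) (X w))%:E * (rho w)%:E)); last first.
  by apply: eq_integral => w _; rewrite hnE ge0_mule_fsuml.
rewrite ge0_integral_fsum//; last 2 first.
- by move=> r; exact: emeasurable_funM (mind r) mrhoE.
- by move=> r w _; apply: mule_ge0; [exact: ind0|rewrite lee_fin].
apply: eq_fsbigr => r _.
under [RHS]eq_integral do rewrite EFinM -muleA.
have [r0|r0] := leP 0%R r; last first.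
  rewrite A0// preimage_set0 measure0 !mule0 integral0_eq// => w _.
  by rewrite indic0 mul0e mule0.
have mindr : measurable_fun setT (fun w => (\1_(A r) (X w))%:E * (rho w)%:E).
  by apply: emeasurable_funM => //; exact/measurable_EFinP.
rewrite ge0_integralZl//; last by move=> w _; rewrite mule_ge0 ?lee_fin.
rewrite muleCA rhoE//; congr (_ * _).
rewrite [LHS]integral_mkcond; apply: eq_integral => w _.
rewrite patchE indicE; have -> : (w \in X @^-1` A r) = (X w \in A r) by apply/idP/idP; rewrite !inE.
by case: ifP => _; rewrite ?mul1e ?mul0e.
Qed.

End Density.

(** * Cheapest options with affine costs *)

Section DecisionRule.
Context {R : realType}.

(** Only the trace on [0, 1] matters, where beliefs live. *)
Definition interval_on01 (S : R -> bool) : Prop :=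
  (forall p, 0 <= p <= 1 -> ~~ S p) \/
  exists a b, [/\ 0 <= a, a <= b, b <= 1 &
    forall p, 0 <= p <= 1 -> S p = (a <= p <= b)].

(** Each affine inequality cuts the interval at a single point, or is constant. *)
Lemma interval_on01_all (A : Type) (u v : A -> R) (cs : seq A) :
  interval_on01 (fun p => all (fun c => u c * p + v c <= 0) cs).
Proof.
elim: cs => [|c cs [IH|[a [b [a0 ab b1 IH]]]]].
- right; exists 0, 1; split=> //; exact: ler01.
- by left=> p /IH /negbTE h; rewrite /= h andbF.
have [u0|u0|u0] := ltrgtP (u c) 0.
- set m := - v c / u c.
  have E p : (u c * p + v c <= 0) = (m <= p).
    by rewrite /m ler_ndivrMr// mulrC; apply/idP/idP => ?; lra.
  have [mb|bm] := leP m b.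
    right; exists (Num.max a m), b; split=> //.
    + by rewrite le_max a0.
    + by rewrite ge_max ab mb.
    + by move=> p p01; rewrite /= E IH// ge_max; case: (m <= p); case: (a <= p).
  left=> p p01; rewrite /= E IH//; apply/negP => /andP[h1 /andP[h2 h3]].
  by have := le_lt_trans (le_trans h1 h3) bm; rewrite ltxx.
- set m := - v c / u c.
  have E p : (u c * p + v c <= 0) = (p <= m).
    by rewrite /m ler_pdivlMr// mulrC; apply/idP/idP => ?; lra.
  have [am|ma] := leP a m.
    right; exists a, (Num.min b m); split=> //.
    + by rewrite le_min ab am.
    + by rewrite ge_min b1.
    + by move=> p p01; rewrite /= E IH// le_min; case: (p <= m); case: (a <= p) => //=; rewrite ?andbT ?andbF.
  left=> p p01; rewrite /= E IH//; apply/negP => /andP[h1 /andP[h2 h3]].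
  by have := le_lt_trans (le_trans h2 h1) ma; rewrite ltxx.
- have E p : (u c * p + v c <= 0) = (v c <= 0) by rewrite u0 mul0r add0r.
  have [v0|v0] := boolP (v c <= 0).
    right; exists a, b; split=> // p p01; by rewrite /= E v0 IH.
  by left=> p p01; rewrite /= E (negbTE v0).
Qed.

Variable I : finType.
Variable L : bool + I -> bool -> R.

(** [p] is the belief that [H] is 0, that is, [false]. *)
Definition mean_cost (e : bool -> R) (p : R) := p * e false + (1 - p) * e true.

Definition best (o : bool + I) (p : R) :=
  [forall o', mean_cost (L o) p <= mean_cost (L o') p].

(** The options are the two messages and the finitely many ways [I] of going on.
    Ties are broken in favour of messages, and of message [z] first: at a belief
    where both intervals of messages meet, the rule with thresholds sends the
    message of the lower interval. *)
Definition chosen (z : bool) (p : R) : bool + I :=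
  if best (inl z) p then inl z
  else if best (inl (~~ z)) p then inl (~~ z)
  else if [pick i | best (inr i) p] is Some i then inr i else inl z.

Definition message (o : bool + I) : option bool :=
  if o is inl z then Some z else None.

Lemma choice_best z p : best (chosen z p) p.
Proof.
rewrite /chosen; case: ifPn => // b1; case: ifPn => // b2.
case: pickP => // nb.
have [c cb] : exists o : bool + I, best o p.
  exists [arg min_(o < inl z) mean_cost (L o) p]%O.
  by case: arg_minP => // o _ h; apply/forallP => o'; exact: h.
case: c cb => [z'|i] cb; last by rewrite nb in cb.
by case: z b1 b2; case: z' cb => ->.
Qed.

Lemma best_interval o : interval_on01 (best o).
Proof.
pose u o' := (L o false - L o true) - (L o' false - L o' true).
pose v o' := L o true - L o' true.
have E p : best o p = all (fun c => u c * p + v c <= 0) (enum (predT : pred (bool + I))).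
  apply/forallP/allP => [h o' _|h o'].
    by move: (h o'); rewrite /mean_cost /u /v => ?; lra.
  by move: (h o' (mem_enum _ _)); rewrite /mean_cost /u /v => ?; lra.
have := interval_on01_all u v (enum (predT : pred (bool + I))).
case=> [h|[a [b [a0 ab b1 h]]]]; [left=> p|right; exists a, b; split=> // p];
  by rewrite E; exact: h.
Qed.

(** The bit [s] exchanges the two messages. *)
Definition threshold_form (rho : R -> option bool) : Prop :=
  exists s alpha beta delta theta,
    [/\ 0 <= alpha <= beta, beta <= delta, delta <= theta <= 1 &
      forall p, 0 <= p <= 1 ->
        omap (addb s) (rho p) = threshold_rule alpha beta delta theta p].

Definition silent (rho : R -> option bool) : Prop :=
  forall p, 0 <= p <= 1 -> rho p = None.

Lemma message_choice z p : message (chosen z p) =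
  if best (inl z) p then Some z
  else if best (inl (~~ z)) p then Some (~~ z) else None.
Proof.
have := choice_best z p; rewrite /chosen.
case: ifPn => // b1; case: ifPn => // b2; case: pickP => // _.
by rewrite (negbTE b1).
Qed.

(** With ordered thresholds the rule is about two intervals, the first of which
    has priority. *)
Lemma threshold_ruleE (a b c e p : R) : a <= b -> b <= c -> c <= e ->
  threshold_rule a b c e p =
  if a <= p <= b then Some true
  else if c <= p <= e then Some false else None.
Proof.
move=> ab bc ce; rewrite /threshold_rule.
have [pa|ap] /= := ltP p a.
  by rewrite (leNgt c p) (lt_le_trans pa (le_trans ab bc)).
have [pb//|bp] /= := leP p b.
by have [pc|cp] /= := ltP p c.
Qed.

(** The two mean costs of the messages differ by an affine function, which has one
    sign on one interval of optimality and the other sign on the other.  If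
    neither interval precedes the other, this function takes both signs in both
    orders, so it vanishes and one message can be dropped.  A message that is
    never optimal is made the upper one, and the upper interval is then
    collapsed to the upper end of the lower interval. *)
Lemma choice_threshold : exists z,
  threshold_form (message \o chosen z) \/ silent (message \o chosen z).
Proof.
have ord z a b c e : 0 <= a -> a <= b -> b <= c -> c <= e -> e <= 1 ->
    (forall p, 0 <= p <= 1 -> best (inl z) p = (a <= p <= b)) ->
    (forall p, 0 <= p <= 1 -> best (inl (~~ z)) p = (c <= p <= e)) ->
    threshold_form (message \o chosen z).
  move=> a0 ab bc ce e1 h h'; exists (~~ z), a, b, c, e; split.
  - by rewrite a0.
  - by [].
  - by rewrite ce.
  move=> p p01; rewrite threshold_ruleE//= message_choice h// h'//.
  by case: ifP; [case: (z)|case: ifP; case: (z)].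
have one z a b : 0 <= a -> a <= b -> b <= 1 ->
    (forall p, 0 <= p <= 1 -> best (inl z) p = (a <= p <= b)) ->
    (forall p, 0 <= p <= 1 -> best (inl (~~ z)) p -> best (inl z) p) ->
    threshold_form (message \o chosen z).
  move=> a0 ab b1 h h'; exists (~~ z), a, b, b, b; split.
  - by rewrite a0.
  - by [].
  - by rewrite lexx.
  move=> p p01; rewrite threshold_ruleE//= message_choice.
  have := h' p p01; rewrite h//.
  case: ifPn => [|apb h1]; first by case: (z).
  have -> : (b <= p <= b) = false.
    apply/negP => /andP[h2 h3]; move: apb; rewrite h3 andbT.
    by rewrite (le_trans ab h2).
  by case: ifP => // /h1.
have [ht|[a [b [a0 ab b1 ht]]]] := best_interval (inl true);
have [hf|[c [e [c0 ce e1 hf]]]] := best_interval (inl false).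
- exists true; right=> p p01; rewrite /= message_choice.
  by rewrite (negbTE (ht _ p01)) (negbTE (hf _ p01)).
- by exists false; left; apply: (one _ c e) => // p p01 /= h; have := ht _ p01; rewrite h.
- by exists true; left; apply: (one _ a b) => // p p01 /= h; have := hf _ p01; rewrite h.
have [bc|cb] := leP b c; first by exists true; left; exact: (ord true a b c e).
have [ea|ae] := leP e a; first by exists false; left; exact: (ord false c e a b).
exists true; left; apply: (one _ a b) => // p p01 /= bf.
have a01 : 0 <= a <= 1 by rewrite a0 (le_trans ab).
have b01 : 0 <= b <= 1 by rewrite b1 (le_trans a0).
have c01 : 0 <= c <= 1 by rewrite c0 (le_trans ce).
have e01 : 0 <= e <= 1 by rewrite e1 (le_trans c0).
have /forallP/(_ (inl false)) Ha : best (inl true) a by rewrite ht// lexx ab.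
have /forallP/(_ (inl false)) Hb : best (inl true) b by rewrite ht// lexx ab.
have /forallP/(_ (inl true)) Hc : best (inl false) c by rewrite hf// lexx ce.
have /forallP/(_ (inl true)) He : best (inl false) e by rewrite hf// lexx ce.
have eqL q : mean_cost (L (inl true)) q = mean_cost (L (inl false)) q.
  move: Ha Hb Hc He; rewrite /mean_cost.
  set t0 := L (inl true) false; set t1 := L (inl true) true.
  set f0 := L (inl false) false; set f1 := L (inl false) true.
  move=> Ha Hb Hc He.
  (* slope of the difference between the costs of the two messages *)
  pose k := (t0 - t1) - (f0 - f1).
  have k0 : k = 0.
    have h1 : k * (b - c) <= 0 by rewrite /k; lra.
    have h2 : k * (e - a) >= 0 by rewrite /k; lra.
    apply/eqP; rewrite eq_le; apply/andP; split.
      by rewrite -(pmulr_lle0 k (_ : 0 < b - c)) ?subr_gt0.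
    by rewrite -(pmulr_lge0 k (_ : 0 < e - a)) ?subr_gt0.
  have hk x : x * k = 0 by rewrite k0 mulr0.
  have := hk a; have := hk q; have := hk c; rewrite /k => ? ? ?; lra.
by apply/forallP => o; rewrite eqL; exact: (forallP bf).
Qed.

End DecisionRule.

(** * The stopping problem of O1 *)

Lemma finite_representatives {X : Type} {C : finType} (kappa : X -> C) (S : set X) :
  exists (I : finType) (xs : I -> X), (forall i, S (xs i)) /\
    forall x, S x -> exists i, kappa (xs i) = kappa x.
Proof.
pose inS c := `[< exists2 x, S x & kappa x = c >].
pose I := {c : C | inS c}.
have ex (i : I) : exists x, S x /\ kappa x = val i.
  by have /asboolP[x Sx kx] := valP i; exists x.
pose xs i := sval (cid (ex i)).
exists I, xs; split=> [i|x Sx]; first by rewrite /xs; case: cid => ? [].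
have cx : inS (kappa x) by apply/asboolP; exists x.
by exists (exist inS _ cx); rewrite /xs; case: cid => ? [].
Qed.

Lemma le_of_truncn {R : realType} (e a b : R) : 0 < e -> 0 <= b ->
  Num.truncn (a / e) = Num.truncn (b / e) -> a <= b + e.
Proof.
move=> e0 b0 E.
have h1 := truncnS_gt (a / e); rewrite E in h1.
have h2 : (Num.truncn (b / e))%:R <= b / e.
  by have /truncn_itv/andP[] : 0 <= b / e by rewrite divr_ge0// ltW.
have : a / e <= b / e + 1 by rewrite (le_trans (ltW h1))// -addn1 natrD lerD2r.
by rewrite ler_pdivrMr// mulrDl divfK ?gt_eqF// mul1r.
Qed.

(** [Q h] stands for the law given [H = h], [p h] for its prior and [a h t z] for
    the cost of stopping at [t] with [z] when [H = h].  The hypothesis [postE]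
    says that [post h t] is the posterior of [h] given the first [t + 1]
    observations; it makes no demand on [Q h] when [p h = 0], which is why
    independence is only assumed for positive priors. *)
Section StoppingProblem.
Context {d : measure_display} {Omega : measurableType d} {R : realType}.
Context {d' : measure_display} {T : measurableType d'}.
Variables (P : probability Omega R) (Q : bool -> probability Omega R) (p : bool -> R).
Variables (Y : nat -> Omega -> T) (bel : forall t, t.+1.-tuple T -> R).
Variables (a : bool -> nat -> bool -> R) (N : nat).

Let path w i := Y i w.
Let past t w := hist (path w) t.
Let post h t (x : t.+1.-tuple T) := if h then 1 - bel x else bel x.

Hypothesis mY : forall i, measurable_fun setT (Y i).
Hypothesis p0 : forall h, 0 <= p h.
Hypothesis indY : forall h, 0 < p h -> forall (s : seq nat) (B : nat -> set T), uniq s ->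
  (forall i, measurable (B i)) ->
  Q h (\bigcap_(i in [set` s]) (Y i @^-1` B i)) = (\prod_(i <- s) Q h (Y i @^-1` B i))%E.
Hypothesis mbel : forall t, measurable_fun setT (@bel t).
Hypothesis bel01 : forall t x, 0 <= @bel t x <= 1.
Hypothesis postE : forall h t A, measurable A ->
  ((p h)%:E * Q h (past t @^-1` A) = \int[P]_(w in past t @^-1` A) (post h (past t w))%:E)%E.
Hypothesis a0 : forall h t z, 0 <= a h t z.

Definition stopping_cost h (g : policy1 T) : \bar R :=
  (\sum_(c : 'I_N.+1 * bool)
    (a h c.1 c.2)%:E * Q h [set w | first_stop (actions g (path w)) c.1 c.2])%E.

Definition average_cost g := (\sum_(h : bool) (p h)%:E * stopping_cost h g)%E.

(** Cost of [g] given [H = h] when the past is [x] and the future is drawn anew. *)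
Definition restart_cost h g t (x : t.+1.-tuple T) : R :=
  \sum_(c : 'I_N.+1 * bool)
    a h c.1 c.2 * fine (Q h [set w | first_stop (actions g (splice x (path w))) c.1 c.2]).

Lemma restart_cost_ge0 h g t (x : t.+1.-tuple T) : 0 <= restart_cost h g x.
Proof. by apply: sumr_ge0 => c _; rewrite mulr_ge0// fine_ge0. Qed.

Lemma restart_cost_le h g t (x : t.+1.-tuple T) :
  admissible1 g -> restart_cost h g x <= \sum_(c : 'I_N.+1 * bool) a h c.1 c.2.
Proof.
move=> mg; apply: ler_sum => c _; rewrite ler_piMr//.
have mA : measurable [set w | first_stop (actions g (splice x (path w))) c.1 c.2].
  apply: fibres_first_stop => k; apply: fibres_actions => // i.
  by apply: measurable_splice => // j; exact: mY.
by rewrite -lee_fin fineK ?fin_num_measure// probability_le1.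
Qed.

Let frozen h g t (c : 'I_N.+1 * bool) (x : t.+1.-tuple T) :=
  Q h [set w | first_stop (actions g (splice x (path w))) c.1 c.2].

Let frozenE h g t c (x : t.+1.-tuple T) : frozen h g c x =
  Q h [set w | @stop_set _ T g c.1 c.2 (hist (splice x (path w)) c.1)].
Proof. by congr (Q h _); apply/funext => w; rewrite /mkset stop_set_hist. Qed.

Let mfrozen h g t c : admissible1 g ->
  measurable_fun setT (fun x : t.+1.-tuple T => frozen h g c x).
Proof.
move=> mg; have := measurable_splice_probability (t := t) (Q h) mY
  (measurable_stop_set (t := c.1) c.2 mg).
by apply: eq_measurable_fun => x _; rewrite frozenE.
Qed.

Let frozen_fin h g t c (x : t.+1.-tuple T) : admissible1 g ->
  frozen h g c x \is a fin_num.
Proof.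
move=> mg; rewrite fin_num_measure//.
apply: fibres_first_stop => k; apply: fibres_actions => // i.
by apply: measurable_splice => // j; exact: mY.
Qed.

Lemma measurable_restart_cost h g t : admissible1 g ->
  measurable_fun setT (fun x : t.+1.-tuple T => restart_cost h g x).
Proof.
move=> mg; apply: measurable_sum => c; apply: measurable_funM => //.
by apply: measurableT_comp (mfrozen _ _ mg).
Qed.

Lemma mpast t : measurable_fun setT (past t).
Proof. exact: measurable_hist. Qed.

Lemma stopping_cost_restart h g t : admissible1 g -> 0 < p h ->
  stopping_cost h g = (\int[Q h]_w (restart_cost h g (past t w))%:E)%E.
Proof.
move=> mg ph.
transitivity (\int[Q h]_w (\sum_(c : 'I_N.+1 * bool)
    (a h c.1 c.2)%:E * frozen h g c (past t w)))%E; last first.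
  apply: eq_integral => w _; rewrite /restart_cost -sumEFin.
  by apply: eq_bigr => c _; rewrite EFinM fineK//; exact: frozen_fin.
have mfp c : measurable_fun setT (fun w => frozen h g c (past t w)).
  by apply: (measurableT_comp (mfrozen h c mg)); exact: mpast.
rewrite ge0_integral_sum//; last 2 first.
- by move=> c; apply: emeasurable_funM.
- by move=> c w _; rewrite mule_ge0 ?lee_fin ?a0.
apply: eq_bigr => c _; rewrite ge0_integralZl//; last by rewrite lee_fin.
congr (_ * _)%E.
transitivity (Q h [set w | @stop_set _ T g c.1 c.2 (hist (path w) c.1)]).
  by congr (Q h _); apply/funext => w; rewrite /mkset stop_set_hist.
rewrite (freeze_past mY (indY ph) t); last exact: measurable_stop_set.
by apply: eq_integral => w _; rewrite frozenE.
Qed.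

Lemma post01 h t (x : t.+1.-tuple T) : 0 <= post h x <= 1.
Proof. by have := bel01 x; rewrite /post; case: h => // h; lra. Qed.

Lemma mpost h t : measurable_fun setT (fun x : t.+1.-tuple T => post h x).
Proof.
by rewrite /post; case: h; [apply: measurable_funB => //|]; exact: mbel.
Qed.

(** Freezing turns the cost given [H = h] into an integral of [restart_cost] over
    the past, and Bayes' rule turns the integrals over both laws into a single
    one weighted by the posterior. *)
Lemma average_cost_restart g t : admissible1 g ->
  average_cost g =
  (\int[P]_w (\sum_(h : bool) post h (past t w) * restart_cost h g (past t w))%:E)%E.
Proof.
move=> mg.
have mr h : measurable_fun setT (fun w => restart_cost h g (past t w)).
  by apply: (measurableT_comp (measurable_restart_cost h mg)); exact: mpast.
have mp h : measurable_fun setT (fun w => post h (past t w)).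
  by apply: (measurableT_comp (@mpost h t)); exact: mpast.
transitivity (\int[P]_w (\sum_(h : bool)
    (post h (past t w) * restart_cost h g (past t w))%:E))%E; last first.
  by apply: eq_integral => w _; rewrite sumEFin.
rewrite ge0_integral_sum//; last 2 first.
- by move=> h; apply/measurable_EFinP; exact: measurable_funM.
- by move=> h w _; rewrite lee_fin mulr_ge0 ?restart_cost_ge0//; case/andP: (post01 h (past t w)).
apply: eq_bigr => h _.
transitivity ((p h)%:E * \int[Q h]_w (restart_cost h g (past t w))%:E)%E.
  have := p0 h; rewrite le_eqVlt => /predU1P[<-|ph]; first by rewrite !mul0e.
  by rewrite (stopping_cost_restart t mg ph).
have post0 w : 0 <= post h (past t w) by case/andP: (post01 h (past t w)).
have mrc : measurable_fun setT (fun x : t.+1.-tuple T => (restart_cost h g x)%:E).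
  by apply/measurable_EFinP; exact: measurable_restart_cost.
rewrite (integral_density (@mpast t) (mp h) post0 (@postE h t) mrc); last first.
  by move=> x; rewrite lee_fin restart_cost_ge0.
by apply: eq_integral => w _; rewrite -EFinM mulrC.
Qed.

Definition alive g t (x : t.+1.-tuple T) : Prop :=
  forall k, (k < t)%N -> actions g (path_of x) k = None.

(** The pairs [restart_cost false], [restart_cost true] are bounded, so a grid of
    mesh [e] has finitely many cells; one past is picked in each cell that is
    met.  Only pasts after which [g] goes on are picked, so that imitating them
    again means to go on. *)
Lemma continuation_net g t (e : R) : admissible1 g -> 0 < e ->
  exists (I : finType) (xs : I -> t.+1.-tuple T),
    (forall i, alive g (xs i) /\ g t (xs i) = None) /\
    forall x : t.+1.-tuple T, alive g x -> g t x = None ->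
      exists i, forall h, restart_cost h g (xs i) <= restart_cost h g x + e.
Proof.
move=> mg e0.
pose M h := Num.truncn ((\sum_(c : 'I_N.+1 * bool) a h c.1 c.2) / e).
pose kap (x : t.+1.-tuple T) :=
  (inord (Num.truncn (restart_cost false g x / e)) : 'I_(M false).+1,
   inord (Num.truncn (restart_cost true g x / e)) : 'I_(M true).+1).
have [I [xs [xsS xsE]]] := finite_representatives kap
  [set x | alive g x /\ g t x = None].
exists I, xs; split=> // x ax gx; have [i [kf kt]] := xsE x (conj ax gx).
have lt h z : (Num.truncn (restart_cost h g (z : t.+1.-tuple T) / e) < (M h).+1)%N.
  by rewrite ltnS le_truncn// ler_pM2r ?invr_gt0// restart_cost_le.
exists i => h; apply: le_of_truncn => //; first exact: restart_cost_ge0.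
case: h; [move: kt|move: kf]; move/(congr1 (@nat_of_ord _)) => /=;
  by rewrite !inordK.
Qed.

Lemma splice_splice s t (x : s.+1.-tuple T) (x' : t.+1.-tuple T) (y : nat -> T) : (t <= s)%N ->
  splice x (splice x' y) = splice x y.
Proof.
move=> ts; apply/funext => i; rewrite /splice; case: leqP => // si.
by rewrite leqNgt (leq_ltn_trans ts si).
Qed.

Section OneStep.
Variables (g : policy1 T) (t : nat) (I : finType) (xs : I -> t.+1.-tuple T) (z0 : bool).
Hypotheses (mg : admissible1 g) (tN : (t <= N)%N).
Hypothesis xsP : forall i, alive g (xs i) /\ g (xs i) = None.

Definition option_cost (c : bool + I) (h : bool) : R :=
  match c with inl z => a h t z | inr i => restart_cost h g (xs i) end.

Definition decision (x : t.+1.-tuple T) : bool + I :=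
  chosen option_cost z0 (bel x).

(** At time [t] the cheapest option is taken at the current belief; if it is to go
    on as after [xs i], all later decisions of [g] are made with the actual past
    replaced by [xs i].  The value [Some true] is never reached, since a message
    has been sent before. *)
Definition revised : policy1 T := fun s y =>
  if (s < t)%N then g y
  else let c := decision (hist (path_of y) t) in
    if s == t then message c
    else if c is inr i then g (hist (splice (xs i) (path_of y)) s) else Some true.

Lemma revised_before (y : nat -> T) k : (k < t)%N -> actions revised y k = actions g y k.
Proof. by move=> kt; rewrite /actions /revised kt. Qed.

Lemma hist_path_of_hist (y : nat -> T) s : (t <= s)%N -> hist (path_of (hist y s)) t = hist y t.
Proof.
move=> ts; apply: eq_hist => i it.
by rewrite /path_of nth_hist// (leq_trans it).
Qed.

Lemma revised_at (y : nat -> T) : actions revised y t = message (decision (hist y t)).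
Proof. by rewrite /actions /revised ltnn eqxx hist_path_of_hist. Qed.

Lemma revised_after (y : nat -> T) s i : (t < s)%N -> decision (hist y t) = inr i ->
  actions revised y s = actions g (splice (xs i) y) s.
Proof.
move=> ts di; rewrite /actions /revised ltnNge (ltnW ts) /= hist_path_of_hist ?(ltnW ts)// di.
by rewrite gtn_eqF// splice_path_of_hist.
Qed.

Lemma hist_splice (x : t.+1.-tuple T) (y : nat -> T) : hist (splice x y) t = x.
Proof. by rewrite hist_splice_le// hist_path_of. Qed.

Lemma actions_splice g' (x : t.+1.-tuple T) (y : nat -> T) k : (k <= t)%N ->
  actions g' (splice x y) k = actions g' (path_of x) k.
Proof. by move=> kt; rewrite /actions hist_splice_le. Qed.

Lemma restart_stopped h g' (x : t.+1.-tuple T) z : alive g' x ->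
  actions g' (path_of x) t = Some z -> restart_cost h g' x = a h t z.
Proof.
move=> al st; have fs y : first_stop (actions g' (splice x y)) t z.
  split=> [|k kt]; first by rewrite actions_splice.
  by rewrite actions_splice 1?ltnW// al.
rewrite /restart_cost (bigD1 (inord t, z))//= inordK// big1 => [|[s u] /= ne].
  rewrite addr0 (_ : mkset _ = setT) ?probability_setT/= ?mulr1//.
  by apply/seteqP; split=> // w _; exact: fs.
rewrite (_ : mkset _ = set0) ?measure0/= ?mulr0//.
apply/seteqP; split=> // w /= fs'; have [e1 e2] := first_stop_uniq (fs (path w)) fs'.
by case/eqP: ne; rewrite e2; congr (_, _); apply/val_inj; rewrite /= inordK.
Qed.

(** [g] has stopped before time [t], where both policies agree. *)
Lemma revised_dead h (x : t.+1.-tuple T) :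
  ~ alive g x -> restart_cost h revised x = restart_cost h g x.
Proof.
move=> /existsNP[k /not_implyP[kt nk]]; rewrite /restart_cost; apply: eq_bigr => c _.
congr (_ * fine (Q h _)); apply/funext => w; apply/propext.
have ag j : (j < t)%N -> actions revised (splice x (path w)) j = actions g (splice x (path w)) j.
  exact: revised_before.
have nk' : actions g (splice x (path w)) k <> None by rewrite actions_splice 1?ltnW.
have agc : (c.1 <= k)%N -> first_stop (actions revised (splice x (path w))) c.1 c.2 <->
    first_stop (actions g (splice x (path w))) c.1 c.2.
  by move=> ck; apply: first_stop_eq => j jc; rewrite ag// (leq_ltn_trans jc) 1?(leq_ltn_trans ck).
have [ck|kc] := leqP c.1 k; first exact: agc.
by rewrite /mkset; split=> -[_ /(_ k kc)]; rewrite ?ag.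
Qed.

(** After [xs i] the policy [g] is silent up to time [t], as [revised] is along
    [x]; so the two sequences of actions coincide, not only their later parts. *)
Lemma revised_alive h (x : t.+1.-tuple T) : alive g x ->
  restart_cost h revised x = option_cost (decision x) h.
Proof.
move=> al; case E : (decision x) => [z|i] /=.
  apply: restart_stopped => [k kt|]; first by rewrite revised_before// al.
  by rewrite revised_at hist_path_of E.
rewrite /restart_cost; apply: eq_bigr => c _; congr (_ * fine (Q h _)); apply/funext => w.
rewrite /mkset; congr (first_stop _ _ _); apply/funext => k.
have [ali gi] := xsP i; case: (ltngtP k t) => [kt|tk|->].
- by rewrite revised_before// !actions_splice 1?ltnW// al// ali.
- by rewrite (@revised_after _ _ i)// ?hist_splice// splice_splice.
- rewrite revised_at hist_splice E/= actions_splice//.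
  by rewrite /actions hist_path_of gi.
Qed.

(** What [g] does after [x] is, up to [e], one of the options among which the
    cheapest was taken. *)
Lemma revised_pointwise (e : R) (x : t.+1.-tuple T) : 0 <= e ->
  (forall x : t.+1.-tuple T, alive g x -> g x = None ->
      exists i, forall h, restart_cost h g (xs i) <= restart_cost h g x + e) ->
  \sum_(h : bool) post h x * restart_cost h revised x <=
  \sum_(h : bool) post h x * restart_cost h g x + e.
Proof.
move=> e0 net; have [al|dead] := pselect (alive g x); last first.
  by rewrite !big_bool/= !revised_dead// lerDl.
rewrite !big_bool/= !revised_alive//.
have /forallP bst := choice_best option_cost z0 (bel x).
have /andP[b0 b1] := bel01 x.
case E : (g x) => [z|].
  rewrite !(@restart_stopped _ g _ z)// ?/actions ?hist_path_of//.
  by have := bst (inl z); rewrite /mean_cost /= -/(decision x) => ?; lra.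
have [i net_i] := net x al E.
have := bst (inr i); rewrite /mean_cost /= -/(decision x).
have h1 : bel x * restart_cost false g (xs i) <= bel x * (restart_cost false g x + e).
  by rewrite ler_wpM2l.
have h2 : (1 - bel x) * restart_cost true g (xs i) <= (1 - bel x) * (restart_cost true g x + e).
  by rewrite ler_wpM2l// subr_ge0.
by move=> ?; lra.
Qed.

(** The decision is a function of the finitely many comparisons between the costs
    of the options. *)
Lemma revised_admissible : admissible1 revised.
Proof.
have mdec : measurable_fibres decision.
  pose cmp (x : t.+1.-tuple T) := [ffun q : (bool + I) * (bool + I) =>
    mean_cost (option_cost q.1) (bel x) <= mean_cost (option_cost q.2) (bel x)].
  have mcmp : measurable_fibres cmp.
    have mmc f : measurable_fun setT (fun x : t.+1.-tuple T => mean_cost f (bel x)).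
      apply: measurable_funD; apply: measurable_funM => //; first exact: mbel.
      by apply: measurable_funB => //; exact: mbel.
    by apply: fibres_ffun => q; apply: fibres_le; exact: mmc.
  pose b (m : {ffun (bool + I) * (bool + I) -> bool}) c := [forall c', m (c, c')].
  pose F m := if b m (inl z0) then inl z0
    else if b m (inl (~~ z0)) then inl (~~ z0)
    else if [pick i | b m (inr i)] is Some i then inr i else inl z0.
  have bE x c : best option_cost c (bel x) = b (cmp x) c.
    by apply: eq_forallb => c'; rewrite ffunE.
  rewrite (_ : decision = fun x => F (cmp x)); first exact: fibres_comp.
  apply/funext => x; rewrite /decision /chosen /F !bE.
  by rewrite (eq_pick (fun i => bE x (inr i))).
move=> s z; move: z; rewrite -/(measurable_fibres (@revised s)) /revised.
have [st|ts] := ltnP s t; first exact: mg.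
have mpo i : measurable_fun setT (fun y : s.+1.-tuple T => path_of y i) by exact: measurable_nth.
have mdec' : measurable_fibres (fun y : s.+1.-tuple T => decision (hist (path_of y) t)).
  by apply: (fibres_precomp _ mdec); exact: measurable_hist.
have [st|st] := eqVneq s t; first exact: (fibres_comp (@message I) mdec').
apply: (fibres_switch (f := fun c (y : s.+1.-tuple T) =>
  if c is inr i then g (hist (splice (xs i) (path_of y)) s) else Some true))
  => // -[z|i].
  exact: fibres_cst.
apply: (fibres_precomp _ (@mg s)); apply: measurable_hist => k.
exact: measurable_splice.
Qed.

End OneStep.

(** Times before [t] are left alone, so that thresholds already in place persist. *)
Lemma improve_at g t (e : R) : admissible1 g -> (t <= N)%N -> 0 < e ->
  (forall y : N.+1.-tuple T, g N y <> None) ->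
  exists g', [/\ admissible1 g', (forall y : N.+1.-tuple T, g' N y <> None),
    (forall s, (s < t)%N -> forall y : s.+1.-tuple T, g' s y = g s y),
    (exists2 rho, threshold_form rho \/ silent rho &
       forall y : t.+1.-tuple T, g' t y = rho (bel y)) &
    (average_cost g' <= average_cost g + e%:E)%E].
Proof.
move=> mg tN e0 gN; have [I [xs [xsP net]]] := continuation_net t mg e0.
have [z0 thr] := choice_threshold (option_cost g xs).
have mg' : admissible1 (revised g xs z0) by exact: revised_admissible.
exists (revised g xs z0); split=> //.
- move=> y; rewrite /revised ltnNge tN /=.
  case: ifPn => [/eqP Nt|Nt]; last by case: (decision _ _ _ _) => // i; exact: gN.
  case: (decision _ _ _ _) => // i; have [_] := xsP i.
  by move: (xs i); rewrite -Nt => x /gN.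
- by move=> s st y; rewrite /revised st.
- exists (@message I \o chosen (option_cost g xs) z0) => // y.
  by rewrite /revised ltnn eqxx hist_path_of.
have mS g1 : admissible1 g1 -> measurable_fun setT (fun w : Omega =>
    \sum_(h : bool) post h (past t w) * restart_cost h g1 (past t w)).
  move=> mg1; apply: measurable_sum => h; apply: measurable_funM.
    by apply: (measurableT_comp (@mpost h t)); exact: mpast.
  by apply: (measurableT_comp (measurable_restart_cost h mg1)); exact: mpast.
have S0 g1 w : 0 <= \sum_(h : bool) post h (past t w) * restart_cost h g1 (past t w).
  by apply: sumr_ge0 => h _; rewrite mulr_ge0 ?restart_cost_ge0//; case/andP: (post01 h (past t w)).
rewrite !(@average_cost_restart _ t)//.
have -> : e%:E = (\int[P]_w (cst e%:E w))%E.
  by rewrite integral_cst//= [X in (_ * X)%E](@probability_setT _ _ _ P) mule1.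
rewrite -ge0_integralD//; last 3 first.
- by move=> w _; rewrite lee_fin.
- by apply/measurable_EFinP; exact: mS.
- by move=> w _; rewrite lee_fin ltW.
apply: ge0_le_integral => //.
- by move=> w _; rewrite lee_fin.
- by apply/measurable_EFinP; exact: mS.
- by apply: emeasurable_funD; [apply/measurable_EFinP; exact: mS|exact: measurable_cst].
- move=> w _; rewrite -EFinD lee_fin.
  by apply: revised_pointwise => //; exact: ltW.
Qed.

Lemma threshold_policy g (e : R) : admissible1 g -> 0 < e ->
  (forall y : N.+1.-tuple T, g N y <> None) ->
  exists g', [/\ admissible1 g', (forall y : N.+1.-tuple T, g' N y <> None),
    (forall t, (t <= N)%N -> exists2 rho, threshold_form rho \/ silent rho &
       forall y : t.+1.-tuple T, g' t y = rho (bel y)) &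
    (average_cost g' <= average_cost g + e%:E)%E].
Proof.
move=> mg e0 gN.
suff main n : (n <= N.+1)%N -> exists g', [/\ admissible1 g',
    (forall y : N.+1.-tuple T, g' N y <> None),
    (forall t, (t < n)%N -> exists2 rho, threshold_form rho \/ silent rho &
       forall y : t.+1.-tuple T, g' t y = rho (bel y)) &
    (average_cost g' <= average_cost g + (n%:R * (e / N.+1%:R))%:E)%E].
  have [g' [? ? ? le]] := main N.+1 (leqnn _); exists g'; split=> //.
  by move: le; rewrite mulrC divfK.
elim: n => [_|n IH nN]; first by exists g; split=> //; rewrite mul0r adde0.
have [g1 [mg1 g1N thr1 le1]] := IH (ltnW nN).
have en : 0 < e / N.+1%:R by rewrite divr_gt0.
have [g2 [mg2 g2N eq2 thr2 le2]] := improve_at mg1 nN en g1N.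
exists g2; split=> // [t|].
  rewrite ltnS leq_eqVlt => /predU1P[->//|tn].
  by have [rho ? rhoE] := thr1 t tn; exists rho => // y; rewrite eq2.
apply: (le_trans le2); rewrite -[n.+1%:R]natr1 mulrDl mul1r EFinD addeA.
by rewrite leeD2r.
Qed.

End StoppingProblem.

(** * Conditional laws and beliefs *)

Section ConditionalLaw.
Context {d : measure_display} {Omega : measurableType d} {R : realType}.
Variables (P : probability Omega R) (H : {RV P >-> bool}).

Lemma measurable_hypothesis h : measurable [set w | H w = h].
Proof.
by rewrite -[mkset _]setTI; exact: (measurable_funP H measurableT [set h] I).
Qed.

Definition prior h : R := fine (P [set w | H w = h]).

Lemma priorE h : P [set w | H w = h] = (prior h)%:E.
Proof. by rewrite fineK// fin_num_measure//; exact: measurable_hypothesis. Qed.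

Lemma prior_ge0 h : 0 <= prior h.
Proof. exact: fine_ge0. Qed.

(** When [H = h] has probability zero, [mnormalize] falls back on [P]; only
    products with [prior h] are ever used then. *)
Definition cond_law h : probability Omega R :=
  mnormalize (mrestr P (measurable_hypothesis h)) P.

Lemma cond_lawE h E : measurable E ->
  (P (E `&` [set w | H w = h]) = (prior h)%:E * cond_law h E)%E.
Proof.
move=> mE; have mh := measurable_hypothesis h.
rewrite /cond_law/= /mnormalize/= /mrestr setTI priorE.
have := prior_ge0 h; rewrite le_eqVlt => /predU1P[p0|p0].
  rewrite -p0 eqxx mul0e; apply/eqP; rewrite eq_le measure_ge0 andbT.
  have : (P (E `&` [set w | H w = h]) <= P [set w | H w = h])%E.
    by apply: le_measure; rewrite ?inE//; exact: measurableI.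
  by rewrite priorE -p0.
rewrite eqe gt_eqF//= muleCA -EFinM divff ?gt_eqF//.
by rewrite mule1.
Qed.

Lemma condP_law h E : 0 < prior h -> measurable E ->
  condP P H h E = fine (cond_law h E).
Proof.
move=> ph mE; rewrite /condP cond_lawE// fineM ?fin_num_measure//.
by rewrite -/(prior h) /= mulrC mulrA mulVf ?gt_eqF// mul1r.
Qed.

End ConditionalLaw.

Section Independence.
Context {d : measure_display} {Omega : measurableType d} {R : realType}.
Context {d1 : measure_display} {T : measurableType d1}.
Variables (P : probability Omega R) (H : {RV P >-> bool}) (Y : nat -> {RV P >-> T}).

Lemma measurable_obs_preimage i (B : set T) : measurable B -> measurable (Y i @^-1` B).
Proof. by move=> mB; rewrite -[_ @^-1` _]setTI; exact: (measurable_funP (Y i)). Qed.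

Lemma cond_law_independent h : 0 < prior H h ->
  mutually_independent (condP P H h) (fun t => Y t : Omega -> T) ->
  forall (s : seq nat) (B : nat -> set T), uniq s -> (forall i, measurable (B i)) ->
  cond_law H h (\bigcap_(i in [set` s]) (Y i @^-1` B i)) =
  (\prod_(i <- s) cond_law H h (Y i @^-1` B i))%E.
Proof.
move=> ph ind s B us mB.
have mYB i : measurable (Y i @^-1` B i) by exact: measurable_obs_preimage.
have mI : measurable (\bigcap_(i in [set` s]) (Y i @^-1` B i)).
  exact: fin_bigcap_measurable.
have fin E : measurable E -> cond_law H h E = (condP P H h E)%:E.
  by move=> mE; rewrite condP_law// fineK// fin_num_measure.
rewrite fin// ind//; under [RHS]eq_bigr do rewrite fin//.
by elim: s {us mI} => [|i s IH]; rewrite ?big_nil// !big_cons EFinM IH.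
Qed.

(** The sets of histories with this property form a sigma-algebra that contains
    the rectangles. *)
Lemma sigma_seq_hist t (F : set (t.+1.-tuple T)) : measurable F ->
  sigma_seq (fun i => Y i : Omega -> T) [set w | F (hist (fun i => Y i w) t)].
Proof.
rewrite measurable_tuple_rectangles; move: F.
set G := mkset _; set S := sigma_seq _.
have SA : sigma_algebra setT S by exact: smallest_sigma_algebra.
suff sub : <<s G >> `<=` [set F | S [set w | F (hist (fun i => Y i w) t)]] by exact: sub.
apply: smallest_sub.
  split.
  - by case: SA => S0 _ _; exact: S0.
  - by move=> A SA'; case: SA => _ SC _; exact: (SC _ SA').
  - by move=> A SA'; case: SA => _ _ SU; exact: (SU _ SA').
move=> _ [B [mB ->]]; rewrite /mkset.
rewrite (_ : (fun w => _) = ~` \bigcup_k (if (k <= t)%N then ~` (Y k @^-1` B k) else set0)).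
  case: SA => S0 SC SU; rewrite -setTD; apply: (SC _); apply: (SU _) => k.
  case: ifP => // _; rewrite -setTD; apply: (SC _).
  by apply: sub_sigma_algebra; exists k, (B k).
apply/seteqP; split=> [w h [k _]|w h i it].
  case: ifP => // kt nB; apply: nB; have := h k kt.
  by rewrite nth_hist.
rewrite nth_hist//; apply: contrapT => nB; apply: h; exists i => //.
by rewrite it.
Qed.

End Independence.

Section Belief.
Context {d : measure_display} {Omega : measurableType d} {R : realType}.
Context {d1 : measure_display} {T : measurableType d1}.
Variables (P : probability Omega R) (H : {RV P >-> bool}) (Y : nat -> {RV P >-> T}).
Variable pi : forall t, t.+1.-tuple T -> R.
Hypothesis piP : is_belief P H (fun t => Y t : Omega -> T) pi.

Lemma null_of_integral_le0 (D : set Omega) (f : Omega -> R) : measurable D ->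
  measurable_fun setT f -> (forall w, D w -> 0 < f w) ->
  (\int[P]_(w in D) (f w)%:E <= 0)%E -> P D = 0%E.
Proof.
move=> mD mf f0 le.
have mfD : measurable_fun D (EFin \o f).
  by apply: measurable_funTS; exact/measurable_EFinP.
have i0 : (\int[P]_(w in D) `|(EFin \o f) w| = 0)%E.
  apply/eqP; rewrite eq_le integral_ge0// andbT.
  apply: le_trans le; rewrite le_eqVlt; apply/orP; left; apply/eqP.
  by apply: eq_integral => w /[!inE] Dw /=; rewrite ger0_norm// ltW// f0.
have /(ae_eq_integral_abs _ mD mfD) [A [mA A0 sub]] := i0.
apply/eqP; rewrite eq_le measure_ge0 andbT -A0 le_measure ?inE//.
move=> w Dw; apply: sub => /= /(_ Dw) /eqP; rewrite eqe gt_eqF//.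
exact: f0.
Qed.

Let past t w := hist (fun i => Y i w) t.

Lemma measurable_past t : measurable_fun setT (past t).
Proof. by apply: measurable_hist => i; exact: measurable_funP. Qed.

Lemma measurable_past_preimage t A : measurable A -> measurable (past t @^-1` A).
Proof. by move=> mA; rewrite -[_ @^-1` _]setTI; exact: measurable_past. Qed.

Lemma belief_integral t A : measurable A ->
  (\int[P]_(w in past t @^-1` A) (pi (past t w))%:E =
   P (past t @^-1` A `&` [set w | H w = false]))%E.
Proof. by have [_ _] := piP t; apply. Qed.

Lemma measurable_belief t : measurable_fun setT (@pi t).
Proof. by have [] := piP t. Qed.

(** The integral of the belief over the event that it is negative is a
    probability, and over the event that it exceeds 1 it is at most the
    probability of that event; both events are therefore null. *)
Lemma belief_ae01 t : {ae P, forall w, 0 <= pi (past t w) <= 1}.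
Proof.
have mpi := measurable_belief (t := t).
have mpp : measurable_fun setT (fun w => pi (past t w)).
  by apply: (measurableT_comp mpi); exact: measurable_past.
have mlow : measurable [set x : t.+1.-tuple T | pi x < 0].
  have := fibres_le (measurable_cst (0 : R)) mpi.
  by move=> /(_ false); congr measurable; apply/seteqP; split=> x /=; rewrite leNgt; case: ltP.
have mhigh : measurable [set x : t.+1.-tuple T | 1 < pi x].
  have := fibres_le mpi (measurable_cst (1 : R)).
  by move=> /(_ false); congr measurable; apply/seteqP; split=> x /=; rewrite leNgt; case: ltP.
exists (past t @^-1` [set x | pi x < 0] `|` past t @^-1` [set x | 1 < pi x]); split.
- by apply: measurableU; exact: measurable_past_preimage.
- apply: null_set_setU; try exact: measurable_past_preimage.
    apply: (@null_of_integral_le0 _ (fun w => - pi (past t w))).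
    + exact: measurable_past_preimage.
    + exact: measurableT_comp.
    + by move=> w /=; rewrite oppr_gt0.
    rewrite -leeN2 oppe0 -integral_ge0N; last first.
      by move=> w /= ?; rewrite lee_fin oppr_ge0 ltW.
    under eq_integral do rewrite -EFinN opprK.
    by rewrite belief_integral.
  apply: (@null_of_integral_le0 _ (fun w => pi (past t w) - 1)).
  + exact: measurable_past_preimage.
  + exact: measurable_funB.
  + by move=> w /=; rewrite subr_gt0.
  set D := past t @^-1` _; have mD : measurable D by exact: measurable_past_preimage.
  have : ((\int[P]_(w in D) (pi (past t w) - 1)%:E) + P D <= P D)%E.
    apply: (@le_trans _ _ (\int[P]_(w in D) (pi (past t w))%:E)%E); last first.
      rewrite belief_integral// le_measure ?inE//; apply: measurableI => //.
      exact: measurable_hypothesis.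
    rewrite -[P D]mul1e -integral_cst// -ge0_integralD//.
    + by under eq_integral do rewrite -EFinD subrK.
    + by move=> w /= ?; rewrite lee_fin subr_ge0 ltW.
    + by apply: measurable_funTS; apply/measurable_EFinP; exact: measurable_funB.
  by rewrite -leeBrDr ?fin_num_measure// subee// fin_num_measure.
move=> w /= /negP; rewrite negb_and -!ltNge => /orP[]; [left|right] => //.
Qed.

(** Beliefs lie in [0, 1] only almost surely; clipping makes it hold everywhere. *)
Definition clipped_belief t (x : t.+1.-tuple T) : R := Num.max 0 (Num.min 1 (pi x)).

Lemma clipped_belief01 t (x : t.+1.-tuple T) : 0 <= clipped_belief x <= 1.
Proof.
by rewrite /clipped_belief le_max lexx/= ge_max ler01/= ge_min lexx.
Qed.

Lemma clipped_belief_id t (x : t.+1.-tuple T) : 0 <= pi x <= 1 ->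
  clipped_belief x = pi x.
Proof. by move=> /andP[h0 h1]; rewrite /clipped_belief min_r// max_r. Qed.

Lemma measurable_clipped_belief t : measurable_fun setT (@clipped_belief t).
Proof.
apply: measurable_maxr => //; apply: measurable_minr => //.
exact: measurable_belief.
Qed.

Lemma clipped_belief_posterior h t A : measurable A ->
  ((prior H h)%:E * cond_law H h (past t @^-1` A) =
   \int[P]_(w in past t @^-1` A)
     (if h then 1 - clipped_belief (past t w) else clipped_belief (past t w))%:E)%E.
Proof.
move=> mA; have mD := measurable_past_preimage mA.
have mcl : measurable_fun setT (fun w => clipped_belief (past t w)).
  by apply: (measurableT_comp (@measurable_clipped_belief t)); exact: measurable_past.
have E0 : (P (past t @^-1` A `&` [set w | H w = false]) =
    \int[P]_(w in past t @^-1` A) (clipped_belief (past t w))%:E)%E.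
  rewrite -belief_integral//; apply: ae_eq_integral => //.
  - apply: measurable_funTS; apply/measurable_EFinP.
    by apply: (measurableT_comp (@measurable_belief t)); exact: measurable_past.
  - by apply: measurable_funTS; exact/measurable_EFinP.
  - have := belief_ae01 t; apply: filterS => w h01 _.
    by rewrite clipped_belief_id.
rewrite -cond_lawE//; case: h; last exact: E0.
have split_ : (P (past t @^-1` A) = P (past t @^-1` A `&` [set w | H w = true]) +
    P (past t @^-1` A `&` [set w | H w = false]))%E.
  rewrite -measureU.
  - congr (P _); rewrite -setIUr; apply/seteqP; split=> [w Aw|w []//].
    by split=> //=; case: (H w); [left|right].
  - by apply: measurableI => //; exact: measurable_hypothesis.
  - by apply: measurableI => //; exact: measurable_hypothesis.
  - by apply/seteqP; split=> // w [[_ /= ->] []].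
have c01 w := clipped_belief01 (past t w).
have sum : (P (past t @^-1` A) = (\int[P]_(w in past t @^-1` A) (1 - clipped_belief (past t w))%:E) +
    \int[P]_(w in past t @^-1` A) (clipped_belief (past t w))%:E)%E.
  rewrite -ge0_integralD//.
  - under eq_integral do rewrite -EFinD subrK.
    by rewrite integral_cst// mul1e.
  - by move=> w _; rewrite lee_fin subr_ge0; case/andP: (c01 w).
  - by apply: measurable_funTS; apply/measurable_EFinP; exact: measurable_funB.
  - by move=> w _; rewrite lee_fin; case/andP: (c01 w).
  - by apply: measurable_funTS; exact/measurable_EFinP.
have fin : P (past t @^-1` A `&` [set w | H w = false]) \is a fin_num.
  by rewrite fin_num_measure//; apply: measurableI => //; exact: measurable_hypothesis.
move: sum; rewrite split_ -E0 => sum.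
by rewrite -[LHS](addeK _ fin) sum addeK.
Qed.

(** The belief has countably many atoms, while [0, 1] is uncountable. *)
Lemma belief_non_atom t : exists2 q : R, 0 <= q <= 1 &
  {ae P, forall w, pi (past t w) <> q}.
Proof.
have mpp : measurable_fun setT (fun w => pi (past t w)).
  by apply: (measurableT_comp (@measurable_belief t)); exact: measurable_past.
pose X : {RV P >-> R} := HB.pack (fun w => pi (past t w)) (isMeasurableFun.Build _ _ _ _ _ mpp).
have cnt := pmf_gt0_countable X.
have [q q01 nq] : exists2 q : R, 0 <= q <= 1 & ~ (0 < pmf X q).
  apply: contrapT => ne.
  have sub : `[0%R, 1%R]%classic `<=` [set r | 0 < pmf X r].
    move=> r /=; rewrite in_itv/= => r01; apply: contrapT => nr.
    by apply: ne; exists r.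
  have := countable_lebesgue_measure0 (sub_countable (subset_card_le sub) cnt).
  by rewrite lebesgue_measure_itv/= lte01 oppr0 adde0 => /eqP; rewrite eqe oner_eq0.
exists q => //.
have mq : measurable (X @^-1` [set q]) by rewrite -[_ @^-1` _]setTI; exact: (measurable_funP X).
exists (X @^-1` [set q]); split=> //.
- move/negP: nq; rewrite -leNgt => le.
  have : pmf X q = 0 by apply/eqP; rewrite eq_le le pmf_ge0.
  rewrite /pmf => e; rewrite -[LHS]fineK ?e//.
  by rewrite fin_num_measure.
- by move=> w /= /contrapT.
Qed.

End Belief.

(** * Costs of single runs *)

Section Runs.
Context {R : realType}.
Variables (c1 c2 L : R) (J : bool -> bool -> R).
Hypotheses (c1_gt0 : 0 < c1) (c2_gt0 : 0 < c2) (JL : forall u h, 0 <= J u h <= L).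
Implicit Types s : nat -> option bool.

Definition sent s t : seq (option bool) :=
  let zs := [seq s k | k <- iota 0 t.+1] in take (find isSome zs).+1 zs.

Definition final_cost s (h : bool) : R :=
  if stop_index s is Some t then
    if s t is Some u then J u h else 0
  else 0.

Definition run_cost s1 s2 (h : bool) : \bar R :=
  (c1%:E * stop_time s1 + c2%:E * stop_time s2 + (final_cost s2 h)%:E)%E.

Lemma stop_time_ge0 s : (0 <= stop_time s :> \bar R)%E.
Proof. by rewrite /stop_time; case: stop_index => [t|]; rewrite ?lee_fin ?leey. Qed.

Lemma final_cost_ge0 s h : 0 <= final_cost s h.
Proof.
rewrite /final_cost; case: stop_index => // t; case: (s t) => // u.
by case/andP: (JL u h).
Qed.

Lemma L_ge0 : 0 <= L.
Proof. by case/andP: (JL true true) => /le_trans; apply. Qed.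

Lemma final_cost_le s h : final_cost s h <= L.
Proof.
rewrite /final_cost; case: stop_index => [t|]; last exact: L_ge0.
by case: (s t) => [u|]; [case/andP: (JL u h)|exact: L_ge0].
Qed.

Lemma run_cost_ge0 s1 s2 h : (0 <= run_cost s1 s2 h)%E.
Proof.
rewrite /run_cost !adde_ge0 ?mule_ge0 ?stop_time_ge0 ?lee_fin ?final_cost_ge0//;
  exact: ltW.
Qed.

Lemma first_stop_time s t z : first_stop s t z -> stop_time s = (t.+1%:R%:E : \bar R).
Proof. by move=> /first_stop_index[st _]; rewrite /stop_time st. Qed.

Lemma first_stop_cost s t z h : first_stop s t z -> final_cost s h = J z h.
Proof. by move=> /first_stop_index[st sz]; rewrite /final_cost st sz. Qed.

Lemma first_stop_run_cost s1 s2 t z t' z' h : first_stop s1 t z -> first_stop s2 t' z' ->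
  run_cost s1 s2 h = (c1 * t.+1%:R + c2 * t'.+1%:R + J z' h)%:E.
Proof.
move=> f1 f2; rewrite /run_cost (first_stop_time f1) (first_stop_time f2).
by rewrite (first_stop_cost h f2) !EFinD !EFinM.
Qed.

Lemma stop_dec s : {tz : nat * bool | first_stop s tz.1 tz.2} + {forall t, s t = None}.
Proof.
have [ex|nex] := pselect (exists tz : nat * bool, first_stop s tz.1 tz.2).
  by left; exact: cid.
right=> t; apply: contrapT => st; apply: nex.
by have [t' [z [_ f]]] := first_stop_ex st; exists (t', z).
Qed.

Lemma never_stop_index s : (forall t, s t = None) -> stop_index s = None.
Proof.
move=> n; rewrite /stop_index; case: pselect => // ex; exfalso.
by case: ex => t; rewrite n.
Qed.

Lemma never_stop_time s : (forall t, s t = None) -> stop_time s = +oo%E :> \bar R.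
Proof. by move=> n; rewrite /stop_time never_stop_index. Qed.

Lemma stop_time_late s N : (forall k, (k < N)%N -> s k = None) ->
  (N.+1%:R%:E <= stop_time s :> \bar R)%E.
Proof.
move=> late; have [[[t z] f]|n] := stop_dec s; last by rewrite never_stop_time// leey.
rewrite (first_stop_time f) lee_fin ler_nat ltnS leqNgt; apply/negP => /late.
by case: f => -> .
Qed.

Definition halt N (u : bool) s t := if (t < N)%N then s t else Some u.

Lemma halt_early N u s t z : (t < N)%N -> first_stop (halt N u s) t z <-> first_stop s t z.
Proof.
by move=> tN; apply: first_stop_eq => k kt; rewrite /halt (leq_ltn_trans kt).
Qed.

Lemma halt_late N u s : (forall k, (k < N)%N -> s k = None) -> first_stop (halt N u s) N u.
Proof. by move=> n; split=> [|k kN]; rewrite /halt ?ltnn// kN n. Qed.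

Lemma early_or_late s N : (exists t z, (t < N)%N /\ first_stop s t z) \/
  (forall k, (k < N)%N -> s k = None).
Proof.
have [[[t z] /= f]|n] := stop_dec s; last by right.
have [tN|Nt] := ltnP t N; first by left; exists t, z.
by right=> k kN; case: f => _; apply; exact: leq_trans kN Nt.
Qed.

Lemma halt_stop_time N u s : (stop_time (halt N u s) <= stop_time s :> \bar R)%E.
Proof.
have [[t [z [tN f]]]|late] := early_or_late s N.
  by rewrite (first_stop_time f) (first_stop_time ((halt_early u _ z tN).2 f)).
by rewrite (first_stop_time (halt_late u late)) stop_time_late.
Qed.

(** If the second sequence stops before [N] then its final action is unchanged,
    and halting only shortens both times; otherwise the final cost is at most
    [L]. *)
Lemma halt_run_cost N u1 u2 s1 s2 h :
  (run_cost (halt N u1 s1) (halt N u2 s2) h <=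
   run_cost s1 s2 h + (L * \1_[set s | forall k, (k < N)%N -> s k = None] s2)%:E)%E.
Proof.
rewrite /run_cost -[leRHS]addeA; apply: leeD.
  by apply: leeD; apply: lee_wpmul2l; rewrite ?lee_fin ?halt_stop_time// ltW.
rewrite -EFinD lee_fin indicE.
have [[t [z [tN f]]]|late] := early_or_late s2 N.
  rewrite (first_stop_cost h f) (first_stop_cost h ((halt_early u2 _ z tN).2 f)).
  by rewrite lerDl mulr_ge0 ?L_ge0.
rewrite mem_set// mulr1 (le_trans (final_cost_le _ _))// lerDr.
exact: final_cost_ge0.
Qed.

(** The transcript freezes at the first final message. *)
Lemma sentE s t z k : first_stop s t z ->
  sent s k = [seq s i | i <- iota 0 (minn k t).+1].
Proof.
move=> [st lt]; rewrite /sent -map_take; congr ([seq s i | i <- _]).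
have [kt|tk] := ltnP k t.
  rewrite take_oversize// size_iota ltnS.
  rewrite hasNfind ?size_map ?size_iota//.
  apply/hasPn => _ /mapP[i + ->]; rewrite mem_iota ltnS => /andP[_ ik].
  by rewrite lt// (leq_ltn_trans ik).
rewrite take_iota; congr iota.
suff -> : find isSome [seq s i | i <- iota 0 k.+1] = t by rewrite (minn_idPl _).
have -> : k.+1 = (t + (k - t).+1)%N by rewrite addnS subnKC.
rewrite iotaD map_cat find_cat ifF; last first.
  apply/hasPn => _ /mapP[i + ->]; rewrite mem_iota => /andP[_ it].
  by rewrite lt.
by rewrite size_map size_iota /= add0n st addn0.
Qed.

(** The transcript only depends on the time and the value of the first final
    message; this is why O2's behaviour is a function of the pair. *)
Lemma eq_sent s s' t z k : first_stop s t z -> first_stop s' t z -> sent s k = sent s' k.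
Proof.
move=> f f'; rewrite (sentE k f) (sentE k f'); apply/eq_in_map => i.
rewrite mem_iota ltnS leq_min => /andP[_ /andP[_]].
case: f f' => st n [st' n']; rewrite leq_eqVlt => /predU1P[->|it].
  by rewrite st st'.
by rewrite n// n'.
Qed.

Lemma eq_sent_prefix s s' k : (forall i, (i <= k)%N -> s i = s' i) -> sent s k = sent s' k.
Proof.
move=> e; rewrite /sent.
have -> // : [seq s i | i <- iota 0 k.+1] = [seq s' i | i <- iota 0 k.+1].
by apply/eq_in_map => i; rewrite mem_iota ltnS => /andP[_]; exact: e.
Qed.

(** A canonical sequence of actions whose transcript is the one left by a first
    stop at [t] with [z]. *)
Definition signal (t : nat) (z : bool) : nat -> option bool :=
  fun k => if k == t then Some z else None.

Lemma first_stop_signal t z : first_stop (signal t z) t z.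
Proof. by split=> [|k kt]; rewrite /signal ?eqxx// ltn_eqF. Qed.

Definition relabel (sg : nat -> bool) s : nat -> option bool :=
  fun t => omap (addb (sg t)) (s t).

Definition relabel_seq (sg : nat -> bool) (zs : seq (option bool)) :=
  mkseq (relabel sg (nth None zs)) (size zs).

Lemma omap_addbK b : involutive (omap (addb b)).
Proof. by case=> //= z; rewrite addKb. Qed.

(** The entry number [k] of a transcript was sent at time [k], so a receiver can
    undo a relabelling that varies with time. *)
Lemma relabel_sent sg s k : relabel_seq sg (sent (relabel sg s) k) = sent s k.
Proof.
have E : find isSome [seq relabel sg s i | i <- iota 0 k.+1] =
    find isSome [seq s i | i <- iota 0 k.+1].
  by rewrite !find_map; apply: eq_find => i /=; rewrite /relabel; case: (s i).
rewrite /sent E -!map_take take_iota.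
set n := minn _ _; rewrite /relabel_seq size_map size_iota /mkseq.
apply/eq_in_map => i; rewrite mem_iota add0n => /andP[_ ik].
by rewrite /relabel (nth_map 0%N) ?size_iota// nth_iota// omap_addbK.
Qed.

Lemma relabel_stop_index sg s : stop_index (relabel sg s) = stop_index s.
Proof.
have fsE t z : first_stop s t z -> first_stop (relabel sg s) t (addb (sg t) z).
  by move=> [st lt]; split=> [|k kt]; rewrite /relabel ?st// lt.
have [[[t z] /= f]|n] := stop_dec s.
  by have /first_stop_index[-> _] := f; have /fsE/first_stop_index[-> _] := f.
by rewrite !never_stop_index// => t; rewrite /relabel n.
Qed.

Lemma relabel_run_cost sg s1 s2 h : run_cost (relabel sg s1) s2 h = run_cost s1 s2 h.
Proof. by rewrite /run_cost /stop_time relabel_stop_index. Qed.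

End Runs.

(** * Expected costs of pairs of policies *)

Lemma integral_partition {d : measure_display} {Omega : measurableType d} {R : realType}
    (P : probability Omega R) (I : finType) (A : I -> set Omega) (K : I -> R)
    (f : Omega -> \bar R) :
  (forall i, measurable (A i)) -> (forall i, 0 <= K i) ->
  (forall w, exists i, [/\ A i w, (forall j, A j w -> j = i) & f w = (K i)%:E]) ->
  (\int[P]_w f w = \sum_i (K i)%:E * P (A i))%E.
Proof.
move=> mA K0 fE.
transitivity (\int[P]_w (\sum_i (K i)%:E * (\1_(A i) w)%:E))%E.
  apply: eq_integral => w _; have [i [Ai uniq ->]] := fE w.
  rewrite (bigD1 i)//= indicE mem_set// mule1 big1 ?adde0// => j ji.
  rewrite indicE memNset ?mule0// => /uniq ij.
  by rewrite ij eqxx in ji.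
have mind i : measurable_fun setT (fun w => (\1_(A i) w)%:E : \bar R).
  by apply/measurable_EFinP; exact: measurable_indic.
rewrite ge0_integral_sum//; last 2 first.
- by move=> i; exact: emeasurable_funM.
- by move=> i w _; rewrite mule_ge0 ?lee_fin.
apply: eq_bigr => i _; rewrite ge0_integralZl//; last by rewrite lee_fin.
by rewrite integral_indic// setIT.
Qed.

Section Costs.
Context {d : measure_display} {Omega : measurableType d} {R : realType}.
Context {d1 d2 : measure_display} {T1 : measurableType d1} {T2 : measurableType d2}.
Variables (P : probability Omega R) (H : {RV P >-> bool}).
Variables (Y1 : nat -> {RV P >-> T1}) (Y2 : nat -> {RV P >-> T2}).
Variables (c1 c2 L : R) (J : bool -> bool -> R).
Hypotheses (c1_gt0 : 0 < c1) (c2_gt0 : 0 < c2) (JL : forall u h, 0 <= J u h <= L).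
Implicit Types (g : policy1 T1) (r : policy2 T2).

Let y1 w i := Y1 i w.
Let y2 w i := Y2 i w.

(** With the messages of O1 fixed, a policy of O2 is a policy on its own
    observations. *)
Definition listening r (s : nat -> option bool) : policy1 T2 :=
  fun t y => r t y (sent s t).

Definition pair_cost g r w : \bar R :=
  let s := actions g (y1 w) in
  run_cost c1 c2 J s (actions (listening r s) (y2 w)) (H w).

Lemma expected_costE g r :
  expected_cost P H Y1 Y2 c1 c2 J g r = (\int[P]_w pair_cost g r w)%E.
Proof. by []. Qed.

Lemma fibres_actions1 g k : admissible1 g ->
  measurable_fibres (fun w => actions g (y1 w) k).
Proof. by move=> mg; apply: fibres_actions => // i; exact: measurable_funP. Qed.

Lemma fibres_sent {X : measurableType d} (s : X -> nat -> option bool) k :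
  (forall t, measurable_fibres (fun x => s x t)) ->
  measurable_fibres (fun x => sent (s x) k).
Proof.
move=> ms.
exact: (fibres_comp (fun zs => take (find isSome zs).+1 zs)
  (fibres_map (f := fun t x => s x t) (iota 0 k.+1) ms)).
Qed.

Lemma admissible_listening r s : admissible2 r -> admissible1 (listening r s).
Proof. by move=> mr t u; exact: mr. Qed.

Lemma fibres_actions2 g r k : admissible1 g -> admissible2 r ->
  measurable_fibres (fun w => actions (listening r (actions g (y1 w))) (y2 w) k).
Proof.
move=> mg mr.
apply: (fibres_switch (k := fun w => sent (actions g (y1 w)) k)
  (f := fun zs w => r k (hist (y2 w) k) zs)) => [|zs].
  by apply: fibres_sent => t; exact: fibres_actions1.
apply: (@fibres_precomp _ _ _ _ _ (fun y => r k y zs)); last by move=> u; exact: mr.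
by apply: measurable_hist => i; exact: measurable_funP.
Qed.

(** The cost is a function of a map with countably many values: the two stopping
    times, the final action and [H]. *)
Lemma measurable_pair_cost g r : admissible1 g -> admissible2 r ->
  measurable_fun setT (pair_cost g r).
Proof.
move=> mg mr.
pose s1 w := actions g (y1 w); pose s2 w := actions (listening r (s1 w)) (y2 w).
pose tm (i : option nat) : \bar R := if i is Some t then t.+1%:R%:E else +oo%E.
pose act w := if stop_index (s2 w) is Some t then s2 w t else None.
pose F (k : (option nat * option nat) * (option bool * bool)) : \bar R :=
  (c1%:E * tm k.1.1 + c2%:E * tm k.1.2 +
   (if k.2.1 is Some u then J u k.2.2 else 0)%:E)%E.
have m1 k : measurable_fibres (fun w => s1 w k) by exact: fibres_actions1.
have m2 k : measurable_fibres (fun w => s2 w k) by exact: fibres_actions2.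
have mact : measurable_fibres act.
  apply: (fibres_switch (k := fun w => stop_index (s2 w))
    (f := fun i w => if i is Some t then s2 w t else None)).
    exact: fibres_stop_index.
  by case=> [t|]; [exact: m2|exact: fibres_cst].
rewrite (_ : pair_cost g r = fun w => F ((stop_index (s1 w), stop_index (s2 w)), (act w, H w))).
  apply: fibres_measurable_fun; apply: fibres_pair; apply: fibres_pair => //.
  - exact: fibres_stop_index.
  - exact: fibres_stop_index.
  - exact: measurable_hypothesis.
apply/funext => w; rewrite /pair_cost/run_cost /F/=; congr (_ + _%:E)%E.
by rewrite /final_cost /act -/(s1 w) -/(s2 w); case: stop_index.
Qed.

Lemma pair_cost_ge0 g r w : (0 <= pair_cost g r w)%E.
Proof. exact: (run_cost_ge0 c1_gt0 c2_gt0 JL). Qed.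

Definition halt1 N g : policy1 T1 := fun t y => halt N true (fun=> g t y) t.
Definition halt2 N r : policy2 T2 := fun t y zs => halt N true (fun=> r t y zs) t.

Lemma admissible_halt1 N g : admissible1 g -> admissible1 (halt1 N g).
Proof.
move=> mg t; rewrite -/(measurable_fibres (@halt1 N g t)) /halt1 /halt.
by case: (leqP N t) => _; [exact: fibres_cst|exact: mg].
Qed.

Lemma admissible_halt2 N r : admissible2 r -> admissible2 (halt2 N r).
Proof.
move=> mr t zs; suff : measurable_fibres (fun y => @halt2 N r t y zs) by [].
rewrite /halt2 /halt; case: (leqP N t) => _; first exact: fibres_cst.
by move=> u; exact: mr.
Qed.

(** Before [N], O2 receives the same messages from the halted policy of O1. *)
Lemma pair_cost_halt N g r w :
  (pair_cost (halt1 N g) (halt2 N r) w <= pair_cost g r w +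
    (L * \1_[set w | forall k, (k < N)%N ->
       actions (listening r (actions g (y1 w))) (y2 w) k = None] w)%:E)%E.
Proof.
have := halt_run_cost c1_gt0 c2_gt0 JL N true true (actions g (y1 w))
   (actions (listening r (actions g (y1 w))) (y2 w)) (H w).
rewrite !indicE; congr (_ <= _)%E.
  rewrite /pair_cost; congr (run_cost _ _ _ _ _ _); apply/funext => k.
  rewrite /actions /listening /halt2 /halt; case: ifP => // kN.
  congr (r _ _ _); apply: eq_sent_prefix => i ik.
  by rewrite /halt1 /halt (leq_ltn_trans ik).
Qed.

(** While O2 is running, the cost is at least [c2] per step, so the probability of
    reaching time [N] is at most the expected cost divided by [c2 * (N + 1)]. *)
Lemma truncation g r e : admissible1 g -> admissible2 r -> 0 < e ->
  (\int[P]_w pair_cost g r w < +oo)%E ->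
  exists N, (\int[P]_w pair_cost (halt1 N g) (halt2 N r) w <=
             \int[P]_w pair_cost g r w + e%:E)%E.
Proof.
move=> mg mr e0 fin.
set C := (\int[P]_w pair_cost g r w)%E in fin *.
have C0 : (0 <= C)%E by apply: integral_ge0 => w _; exact: pair_cost_ge0.
have Cfin : C \is a fin_num by rewrite ge0_fin_numE.
pose s2 w := actions (listening r (actions g (y1 w))) (y2 w).
pose late N := [set w | forall k, (k < N)%N -> s2 w k = None].
have mlate N : measurable (late N).
  rewrite (_ : late N = \bigcap_(k in `I_N) [set w | s2 w k = None]).
    by apply: fin_bigcap_measurable => // k _; exact: fibres_actions2.
  by apply/seteqP; split.
have mpc := measurable_pair_cost mg mr.
have L0 := L_ge0 JL.
have Plate N : ((c2 * N.+1%:R)%:E * P (late N) <= C)%E.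
  rewrite -[X in (_ * P X)%E]setIT -integral_indic// -ge0_integralZl//; last 2 first.
  - by apply/measurable_EFinP; exact: measurable_indic.
  - by rewrite lee_fin mulr_ge0// ltW.
  apply: ge0_le_integral => //.
  - by move=> w _; rewrite mule_ge0// lee_fin// mulr_ge0// ltW.
  - by apply: emeasurable_funM => //; apply/measurable_EFinP; exact: measurable_indic.
  move=> w _; rewrite indicE; have [wl|wl] := boolP (w \in late N); last first.
    by rewrite mule0 pair_cost_ge0.
  rewrite mule1 EFinM; move/set_mem : wl => wl.
  apply: (@le_trans _ _ (c2%:E * stop_time (s2 w))%E).
    by apply: lee_wpmul2l; [rewrite lee_fin ltW|exact: stop_time_late].
  rewrite /pair_cost /run_cost -/(s2 w) addeAC leeDr// adde_ge0//.
    by rewrite mule_ge0 ?stop_time_ge0// lee_fin ltW.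
  by rewrite lee_fin (final_cost_ge0 JL).
(* [Plate N] makes the late event cost at most [L * C / (c2 * (N + 1))]. *)
have [N NE] : exists N : nat, L * fine C / (c2 * e) <= N.+1%:R.
  exists (Num.truncn (L * fine C / (c2 * e))); exact: ltW (truncnS_gt _).
have LP : (L%:E * P (late N) <= e%:E)%E.
  have PN := Plate N.
  have pf : P (late N) \is a fin_num by rewrite fin_num_measure.
  move: PN; rewrite -(fineK pf) -(fineK Cfin) -!EFinM !lee_fin.
  set q := fine (P (late N)) => PN.
  have q0 : 0 <= q by exact: fine_ge0.
  rewrite ler_pdivrMr ?mulr_gt0// in NE.
  have h1 : L * (c2 * N.+1%:R * q) <= L * fine C by rewrite ler_wpM2l.
  have h2 : (c2 * N.+1%:R) * (L * q) <= (c2 * N.+1%:R) * e.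
    apply: (@le_trans _ _ (L * fine C)); last by rewrite [c2 * _]mulrC -mulrA.
    by rewrite mulrCA.
  by rewrite ler_pM2l ?mulr_gt0 in h2.
exists N; apply: (@le_trans _ _ (\int[P]_w (pair_cost g r w + (L * \1_(late N) w)%:E))%E).
  apply: ge0_le_integral => //.
  - by move=> w _; exact: pair_cost_ge0.
  - by apply: measurable_pair_cost; [exact: admissible_halt1|exact: admissible_halt2].
  - apply: emeasurable_funD => //; apply/measurable_EFinP; apply: measurable_funM;
      [exact: measurable_cst|exact: measurable_indic].
  - by move=> w _; exact: pair_cost_halt.
rewrite ge0_integralD//; last 3 first.
- by move=> w _; exact: pair_cost_ge0.
- by move=> w _; rewrite lee_fin mulr_ge0.
- by apply/measurable_EFinP; apply: measurable_funM;
    [exact: measurable_cst|exact: measurable_indic].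
rewrite leeD2l//; under eq_integral do rewrite EFinM.
rewrite ge0_integralZl//; last by apply/measurable_EFinP; exact: measurable_indic.
by rewrite integral_indic// setIT.
Qed.

Lemma first_stop_pair_cost g r w t z t' z' :
  first_stop (actions g (y1 w)) t z ->
  first_stop (actions (listening r (signal t z)) (y2 w)) t' z' ->
  pair_cost g r w = (c1 * t.+1%:R + c2 * t'.+1%:R + J z' (H w))%:E.
Proof.
move=> f1 f2.
have e : actions (listening r (actions g (y1 w))) (y2 w) =
    actions (listening r (signal t z)) (y2 w).
  apply/funext => k; rewrite /actions /listening; congr (r _ _ _).
  exact: eq_sent f1 (first_stop_signal t z).
by rewrite /pair_cost e; apply: first_stop_run_cost; [exact: f1|exact: f2].
Qed.

Section FiniteHorizon.
Variables (N : nat) (r : policy2 T2).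
Hypothesis mr : admissible2 r.
Hypothesis rN : forall y zs, r (t := N) y zs <> None.
Hypothesis indY1 : forall h, 0 < prior H h ->
  mutually_independent (condP P H h) (fun t => Y1 t : Omega -> T1).
Hypothesis indY12 : forall h, 0 < prior H h ->
  independent_seqs (condP P H h) (fun t => Y1 t : Omega -> T1) (fun t => Y2 t : Omega -> T2).

Definition response_event (c : nat * bool) (e : nat * bool) : set Omega :=
  [set w | first_stop (actions (listening r (signal c.1 c.2)) (y2 w)) e.1 e.2].

Definition signal_cost (h : bool) (t : nat) (z : bool) : R :=
  \sum_(e : 'I_N.+1 * bool) fine (cond_law H h (response_event (t, z) (val e.1, e.2))) *
    (c1 * t.+1%:R + c2 * e.1.+1%:R + J e.2 h).

Lemma run_price_ge0 (t t' : nat) u h : 0 <= c1 * t.+1%:R + c2 * t'.+1%:R + J u h.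
Proof.
case/andP: (JL u h) => Ju _.
by rewrite !addr_ge0// mulr_ge0// ltW.
Qed.

Lemma signal_cost_ge0 h t z : 0 <= signal_cost h t z.
Proof. by apply: sumr_ge0 => e _; rewrite mulr_ge0 ?fine_ge0// run_price_ge0. Qed.

(** The probability space is partitioned by [H], by the first stop of O1, and by
    the first stop of O2 when it listens to the corresponding [signal].  Given
    [H] the last two events are independent, and the sum over the last one is
    [signal_cost]. *)
Lemma expected_cost_average g : admissible1 g -> (forall y, g N y <> None) ->
  (\int[P]_w pair_cost g r w =
   average_cost (cond_law H) (prior H) (fun i => Y1 i : Omega -> T1) signal_cost N g)%E.
Proof.
move=> mg gN.
pose cell := ('I_N.+1 * bool)%type.
pose E (c : cell) := [set w | first_stop (actions g (y1 w)) c.1 c.2].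
pose F (c e : cell) := response_event (val c.1, c.2) (val e.1, e.2).
have mE c : measurable (E c).
  by apply: fibres_first_stop => k; exact: fibres_actions1.
have mF c e : measurable (F c e).
  apply: fibres_first_stop => k; apply: fibres_actions; first exact: admissible_listening.
  by move=> i; exact: measurable_funP.
have mH h := measurable_hypothesis H h.
pose A (i : bool * (cell * cell)) := E i.2.1 `&` F i.2.1 i.2.2 `&` [set w | H w = i.1].
pose K (i : bool * (cell * cell)) : R :=
  c1 * i.2.1.1.+1%:R + c2 * i.2.2.1.+1%:R + J i.2.2.2 i.1.
rewrite (@integral_partition _ _ _ P _ A K); last 3 first.
- by move=> i; apply: measurableI => //; exact: measurableI.
- by move=> i; exact: run_price_ge0.
- move=> w.
  have [t [z [tN f]]] := first_stop_ex (gN (hist (y1 w) N) : actions g (y1 w) N <> None).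
  have [t' [z' [tN' f']]] : exists t' z', (t' <= N)%N /\
      first_stop (actions (listening r (signal t z)) (y2 w)) t' z'.
    by apply: first_stop_ex; exact: rN.
  exists (H w, ((inord t, z), (inord t', z'))); split.
  + by rewrite /A /E /F /response_event /= !inordK ?ltnS.
  + move=> [h [[s u] [s' u']]] [[/= f1 f2] <-]; have [/= e1 e2] := first_stop_uniq f f1.
    move: f2; rewrite /F /response_event/= -e1 -e2 => f2.
    have [/= e1' e2'] := first_stop_uniq f' f2.
    by congr (_, ((_, _), (_, _))) => //; apply/val_inj; rewrite /= inordK ?ltnS.
  + by rewrite (first_stop_pair_cost f f') /K/= !inordK ?ltnS.
pose qE h c := fine (cond_law H h (E c)).
pose qF h c e := fine (cond_law H h (F c e)).
have PA i : P (A i) = (prior H i.1 * (qE i.1 i.2.1 * qF i.1 i.2.1 i.2.2))%:E.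
  case: i => h [c e] /=; rewrite /A cond_lawE/=; last exact: measurableI.
  have := prior_ge0 H h; rewrite le_eqVlt => /predU1P[<-|ph]; first by rewrite mul0e mul0r.
  rewrite EFinM; congr (_ * _)%E.
  have sE : sigma_seq (fun t => Y1 t : Omega -> T1) (E c).
    have := sigma_seq_hist (Y := Y1) (measurable_stop_set (t := c.1) c.2 mg).
    by congr (sigma_seq _ _); apply/funext => w; rewrite /mkset stop_set_hist.
  have sF : sigma_seq (fun t => Y2 t : Omega -> T2) (F c e).
    have := sigma_seq_hist (Y := Y2) (measurable_stop_set (t := e.1) e.2
      (admissible_listening (signal c.1 c.2) mr)).
    by congr (sigma_seq _ _); apply/funext => w; rewrite /mkset stop_set_hist.
  have := indY12 ph sE sF; rewrite !condP_law//; last exact: measurableI.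
  by rewrite /qE /qF => <-; rewrite fineK// fin_num_measure//; exact: measurableI.
transitivity ((\sum_(i : bool * (cell * cell))
    K i * (prior H i.1 * (qE i.1 i.2.1 * qF i.1 i.2.1 i.2.2)))%:E).
  by rewrite -sumEFin; apply: eq_bigr => i _; rewrite PA EFinM.
transitivity ((\sum_(h : bool) prior H h *
    \sum_(c : cell) signal_cost h c.1 c.2 * qE h c)%:E); last first.
  rewrite /average_cost -sumEFin; apply: eq_bigr => h _.
  rewrite EFinM; congr (_ * _)%E; rewrite /stopping_cost -sumEFin; apply: eq_bigr => c _.
  by rewrite EFinM /qE fineK// fin_num_measure.
congr EFin; rewrite -(pair_bigA _ (fun h i => K (h, i) * (prior H h * (qE h i.1 * qF h i.1 i.2))))/=.
apply: eq_bigr => h _.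
rewrite -(pair_bigA _ (fun c e => K (h, (c, e)) * (prior H h * (qE h c * qF h c e))))/=.
rewrite mulr_sumr; apply: eq_bigr => c _.
rewrite /signal_cost mulr_suml mulr_sumr; apply: eq_bigr => e _.
rewrite -/(qF h c e) /K /=; set k := (X in X * (prior H h * _) = _).
by rewrite mulrCA; congr (_ * _); rewrite mulrCA [RHS]mulrC; congr (_ * _); rewrite mulrC.
Qed.

End FiniteHorizon.

Definition relabel1 (sg : nat -> bool) g : policy1 T1 :=
  fun t y => omap (addb (sg t)) (g t y).
Definition relabel2 (sg : nat -> bool) r : policy2 T2 :=
  fun t y zs => r t y (relabel_seq sg zs).

(** The stopping times do not see the labels, and O2 restores them. *)
Lemma pair_cost_relabel sg g r w :
  pair_cost (relabel1 sg g) (relabel2 sg r) w = pair_cost g r w.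
Proof.
rewrite /pair_cost; set s := actions g (y1 w).
have -> : actions (relabel1 sg g) (y1 w) = relabel sg s by [].
rewrite relabel_run_cost; congr run_cost.
by apply/funext => k; rewrite /actions /listening /relabel2 relabel_sent.
Qed.

Lemma admissible_relabel1 sg g : admissible1 g -> admissible1 (relabel1 sg g).
Proof. by move=> mg t; exact: (fibres_comp (omap (addb (sg t))) (@mg t)). Qed.

Lemma admissible_relabel2 sg r : admissible2 r -> admissible2 (relabel2 sg r).
Proof. by move=> mr t zs u; exact: mr. Qed.

(** A policy that surely stops by [N] is not affected by what it does later. *)
Lemma expected_cost_ae N g g' r : admissible1 g -> admissible1 g' -> admissible2 r ->
  (forall y, g N y <> None) ->
  (forall t, {ae P, forall w, (t <= N)%N -> g t (hist (y1 w) t) = g' t (hist (y1 w) t)}) ->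
  (\int[P]_w pair_cost g r w = \int[P]_w pair_cost g' r w)%E.
Proof.
move=> mg mg' mr gN ae.
apply: ge0_ae_eq_integral => //.
- exact: measurable_pair_cost.
- exact: measurable_pair_cost.
- by move=> w _; exact: pair_cost_ge0.
- by move=> w _; exact: pair_cost_ge0.
have := ae_foralln ae; apply: filterS => w eqw _.
have [t [z [tN f]]] := first_stop_ex (gN (hist (y1 w) N) : actions g (y1 w) N <> None).
have f' : first_stop (actions g' (y1 w)) t z.
  by apply: (first_stop_eq _ _).1 f => k kt; apply: eqw; exact: leq_trans tN.
rewrite /pair_cost /run_cost (first_stop_time f) (first_stop_time f').
have -> // : actions (listening r (actions g (y1 w))) (y2 w) =
  actions (listening r (actions g' (y1 w))) (y2 w).
by apply/funext => k; rewrite /actions /listening; congr (r _ _ _); exact: eq_sent f f'.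
Qed.

End Costs.

(** * Threshold policies *)

Lemma fibres_threshold_rule {d : measure_display} {X : measurableType d} {R : realType}
    (a b c e : R) (f : X -> R) : a <= b -> b <= c -> c <= e ->
  measurable_fun setT f -> measurable_fibres (fun x => threshold_rule a b c e (f x)).
Proof.
move=> ab bc ce mf.
pose F (k : (bool * bool) * (bool * bool)) : option bool :=
  if k.1.1 && k.1.2 then Some true else if k.2.1 && k.2.2 then Some false else None.
rewrite (_ : (fun x => _) = fun x => F ((a <= f x, f x <= b), (c <= f x, f x <= e))); last first.
  by apply/funext => x; rewrite threshold_ruleE.
apply: (fibres_comp F); apply: fibres_pair; apply: fibres_pair; exact: fibres_le.
Qed.

Theorem theorem9 (R : realType)
  (d : measure_display) (Omega : measurableType d) (P : probability Omega R)
  (d1 : measure_display) (T1 : measurableType d1)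
  (d2 : measure_display) (T2 : measurableType d2)
  (H : {RV P >-> bool})
  (Y1 : nat -> {RV P >-> T1}) (Y2 : nat -> {RV P >-> T2})
  (nu1 : {sigma_finite_measure set T1 -> \bar R})
  (nu2 : {sigma_finite_measure set T2 -> \bar R})
  (p0 : R) (c1 c2 L : R) (J : bool -> bool -> R)
  (hprior0 : P [set w | H w = false] = p0%:E)
  (hprior1 : P [set w | H w = true] = (1 - p0)%:E)
  (hobs : observation_model P H nu1 nu2 Y1 Y2)
  (hc1 : 0 < c1) (hc2 : 0 < c2)
  (hJ : forall u h, 0 <= J u h <= L)
  (hJ1 : J true true < J false true)
  (hJ0 : J false false < J true false)
  (pi1 : forall t, t.+1.-tuple T1 -> R)
  (hpi1 : is_belief P H Y1 pi1)
  (eps : R) (heps : 0 < eps) :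
  exists (g1 : policy1 T1) (g2 : policy2 T2),
    [/\ admissible1 g1, admissible2 g2,
        (expected_cost P H Y1 Y2 c1 c2 J g1 g2 <=
           optimal_cost P H Y1 Y2 c1 c2 J + eps%:E)%E &
        exists alpha beta delta theta : nat -> R, forall t,
          [/\ 0 <= alpha t <= beta t, beta t <= delta t,
              delta t <= theta t <= 1 &
              forall y : t.+1.-tuple T1,
                g1 t y = threshold_rule (alpha t) (beta t) (delta t) (theta t)
                           (pi1 t y)]].

Proof.
have pos h : 0 < prior H h -> (0 < P [set w | H w = h])%E.
  by rewrite priorE lte_fin.
have indY1 h : 0 < prior H h ->
    mutually_independent (condP P H h) (fun t => Y1 t : Omega -> T1).
  by move=> /pos/hobs[].
have indY12 h : 0 < prior H h -> independent_seqs (condP P H h)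
    (fun t => Y1 t : Omega -> T1) (fun t => Y2 t : Omega -> T2).
  by move=> /pos/hobs[].
pose cost g r := (\int[P]_w pair_cost H Y1 Y2 c1 c2 J g r w)%E.
set opt := optimal_cost P H Y1 Y2 c1 c2 J.
have cost0 g r : (0 <= cost g r)%E.
  by apply: integral_ge0 => w _; exact: (pair_cost_ge0 H Y1 Y2 hc1 hc2 hJ).
have opt_le g r : admissible1 g -> admissible2 r -> (opt <= cost g r)%E.
  by move=> mg mr; apply: ereal_inf_lbound; exists g, r.
have opt0 : (0 <= opt)%E.
  by apply/ereal_infP => _ [g [r [_ _ ->]]]; exact: cost0.
have e40 : 0 < eps / 4 by rewrite divr_gt0.
have optoo : (opt < +oo)%E.
  (* Stopping at once bounds the infimum, which must be finite for a
     near-optimal pair to exist. *)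
  pose g0 : policy1 T1 := fun _ _ => Some true.
  pose r0 : policy2 T2 := fun _ _ _ => Some true.
  have mg0 : admissible1 g0 by move=> t; exact: fibres_cst.
  have mr0 : admissible2 r0 by move=> t zs; exact: fibres_cst.
  apply: (le_lt_trans (opt_le g0 r0 mg0 mr0)).
  apply: (@le_lt_trans _ _ (\int[P]_w (cst (c1 + c2 + L)%:E w))%E); last first.
    by rewrite integral_cst// [X in (_ * X)%E](@probability_setT _ _ _ P) mule1 ltry.
  apply: ge0_le_integral => //.
  - by move=> w _; exact: (pair_cost_ge0 H Y1 Y2 hc1 hc2 hJ).
  - exact: (measurable_pair_cost H Y1 Y2 c1 c2 J).
  - move=> w _; rewrite (@first_stop_pair_cost _ _ _ _ _ _ _ P H Y1 Y2 c1 c2 J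
      g0 r0 w 0 true 0 true)//.
    by rewrite lee_fin !mulr1 lerD2l; case/andP: (hJ true (H w)).
have optfin : opt \is a fin_num by rewrite ge0_fin_numE.
have [x [g [r [mg mr xE]]] x_lt] := lb_ereal_inf_adherent e40 optfin.
have {x xE x_lt} cost_gr : (cost g r <= opt + (eps / 4)%:E)%E.
  by rewrite xE in x_lt; exact: ltW.
have cost_gr_fin : (cost g r < +oo)%E.
  by apply: (le_lt_trans cost_gr); rewrite -(fineK optfin) -EFinD ltry.
have [N cost_halt] := truncation hc1 hc2 hJ mg mr e40 cost_gr_fin.
set hg := halt1 N g in cost_halt; set hr := halt2 N r in cost_halt.
have mhg : admissible1 hg by exact: admissible_halt1.
have mhr : admissible2 hr by exact: admissible_halt2.
have hgN y : hg N y <> None by rewrite /hg /halt1 /halt ltnn.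
have hrN y zs : hr N y zs <> None by rewrite /hr /halt2 /halt ltnn.
have avg := expected_cost_average hc1 hc2 hJ mhr hrN indY12.
have [g' [mg' g'N thr le_avg]] := threshold_policy
  (fun i => measurable_funP (Y1 i)) (prior_ge0 H)
  (fun h ph => cond_law_independent ph (indY1 h ph))
  (measurable_clipped_belief hpi1) (clipped_belief01 pi1)
  (fun h t A => clipped_belief_posterior hpi1 h (A := A))
  (signal_cost_ge0 H Y2 hc1 hc2 hJ N hr) mhg e40 hgN.
rewrite -!avg// in le_avg.
have rule t : exists q : bool * (R * R * (R * R)),
    [/\ 0 <= q.2.1.1 <= q.2.1.2, q.2.1.2 <= q.2.2.1, q.2.2.1 <= q.2.2.2 <= 1 &
     {ae P, forall w, (t <= N)%N ->
       omap (addb q.1) (g' t (hist (fun i => Y1 i w) t)) =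
       threshold_rule q.2.1.1 q.2.1.2 q.2.2.1 q.2.2.2 (pi1 t (hist (fun i => Y1 i w) t))}].
  have [tN|Nt] := leqP t N; last first.
    by exists (false, ((0, 0), (0, 0))); split; rewrite /= ?lexx ?ler01//; exact: aeW.
  have [rho [[s [a [b [c [e [ab bc ce rhoE]]]]]]|mute] g'E] := thr t tN.
    exists (s, ((a, b), (c, e))); split=> //=.
    have := belief_ae01 hpi1 t; apply: filterS => w pi01 _.
    by rewrite g'E clipped_belief_id// rhoE.
  (* No message is ever optimal: the thresholds collapse to a value that the
     belief almost surely avoids. *)
  have [q q01 nq] := belief_non_atom hpi1 t.
  have /andP[q0 q1] := q01.
  exists (false, ((q, q), (q, q))); split; rewrite /= ?lexx ?q0 ?q1//.
  have := belief_ae01 hpi1 t; apply: filterS2 nq => w nqw pi01 _.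
  rewrite g'E mute ?clipped_belief01// threshold_ruleE//.
  case: ifP => [/andP[qp pq]|->//].
  by case: nqw; apply: le_anti; rewrite pq qp.
pose q t := sval (cid (rule t)).
have qP t := svalP (cid (rule t)).
pose sg t := (q t).1.
pose gf : policy1 T1 := fun t y => threshold_rule (q t).2.1.1 (q t).2.1.2
  (q t).2.2.1 (q t).2.2.2 (pi1 t y).
have mgf : admissible1 gf.
  move=> t; have [/andP[_ ab] bc /andP[ce _] _] := qP t.
  by apply: fibres_threshold_rule => //; exact: (measurable_belief hpi1).
exists gf, (relabel2 sg hr); split=> //.
- exact: admissible_relabel2.
- rewrite expected_costE.
  rewrite -(@expected_cost_ae _ _ _ _ _ _ _ P H Y1 Y2 c1 c2 L J hc1 hc2 hJ N
    (relabel1 sg g')) //.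
  + under eq_integral do rewrite pair_cost_relabel.
    apply: (le_trans le_avg); apply: (@le_trans _ _ (cost g r + (eps / 4)%:E + (eps / 4)%:E)%E).
      by rewrite leeD2r.
    apply: (@le_trans _ _ (opt + (eps / 4)%:E + (eps / 4)%:E + (eps / 4)%:E)%E).
      by rewrite !leeD2r.
    (* three errors of eps / 4 each: the initial pair, halting, thresholds *)
    rewrite -!addeA leeD2l// -!EFinD lee_fin; lra.
  + exact: admissible_relabel1.
  + exact: admissible_relabel2.
  + by move=> y; rewrite /relabel1; case: (g' N y) (g'N y).
  + by move=> t; have [_ _ _] := qP t.
- exists (fun t => (q t).2.1.1), (fun t => (q t).2.1.2).
  exists (fun t => (q t).2.2.1), (fun t => (q t).2.2.2).
  by move=> t; have [h1 h2 h3 _] := qP t; split.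
Qed.
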